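(* Let $N\ge1$, let $\mathbf{z}=(z_1>\cdots>z_N)$ be a fixed top row, and let $\mathsf{a}=(\mathsf{a}_1,\ldots,\mathsf{a}_N)\in\mathbb{R}^N$ be fixed. For $\beta>0$ let $\{y_i^k(\beta)\}_{1\le i\le k\le N}$ be the perturbed $\beta$-corners process with scaled perturbation $a_i=\frac{\beta}{2}\mathsf{a}_i$, $i=1,\ldots,N$, and fixed top row $\mathbf{z}$. Let $\{\bar{\mathsf{y}}_i^k\}_{1\le i\le k\le N}$ be the deformed $\infty$-corners lattice with top row $\mathbf{z}$ and parameters $\mathsf{a}$, and let $\{\bar\zeta_i^k\}_{1\le i\le k\le N}$ be the deformed discrete Gaussian Free Field on it. Then, as $\beta\to\infty$, $$\sqrt{\beta}\,\bigl(y_i^k(\beta)-\bar{\mathsf{y}}_i^k\bigr)\to\bar\zeta_i^k\quad\text{in distribution, jointly for all }1\le i\le k\le N.$$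
   Context: Interlacing: for $\mathbf{u}=(u_1\ge\cdots\ge u_k)$ and $\mathbf{w}=(w_1\ge\cdots\ge w_{k+1})$, $\mathbf{u}\prec\mathbf{w}$ means $w_1\ge u_1\ge w_2\ge\cdots\ge u_k\ge w_{k+1}$. Perturbed $\beta$-corners process with perturbation $\mathbf{a}=(a_1,\ldots,a_N)$ and fixed top row $\mathbf{z}$: a random array with levels $\mathbf{y}^k=(y_1^k\ge\cdots\ge y_k^k)$, $k=1,\ldots,N$, with $\mathbf{y}^N=\mathbf{z}$ deterministic, whose lower levels $\mathbf{Y}=(\mathbf{y}^1,\ldots,\mathbf{y}^{N-1})$ have the probability density (with respect to Lebesgue measure on $\mathbb{R}^{N(N-1)/2}$) proportional, as a function of $\mathbf{Y}$, to $$\mathbf{1}_{\mathbf{y}^1\prec\cdots\prec\mathbf{y}^{N-1}\prec\mathbf{z}}\prod_{k=1}^{N-1}\Bigl(\prod_{1\le i<j\le k}(y_i^k-y_j^k)^{2-\beta}\prod_{p=1}^k\prod_{q=1}^{k+1}|y_p^k-y_q^{k+1}|^{\beta/2-1}\Bigr)\exp\Bigl[\sum_{k=1}^{N-1}\sum_{i=1}^k y_i^k(a_k-a_{k+1})\Bigr].$$ (This is the conditional density of $\mathbf{Y}$ given the top row in the perturbed Gaussian $\beta$-corners process.) Deformed $\infty$-corners lattice with top row $\mathbf{z}$ and parameters $\mathsf{a}$: $\bar{\mathsf{y}}_i^N=z_i$ for $i=1,\ldots,N$, and $\bar{\mathsf{Y}}=\{\bar{\mathsf{y}}_i^k\}_{1\le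 i\le k\le N-1}$ is the unique solution of the coupled equations $$\sum_{\substack{1\le j\le k\\ j\ne i}}\frac{1}{\bar{\mathsf{y}}_i^k-\bar{\mathsf{y}}_j^k}-\frac12\sum_{q=1}^{k+1}\frac{1}{\bar{\mathsf{y}}_i^k-\bar{\mathsf{y}}_q^{k+1}}-\frac12\sum_{p=1}^{k-1}\frac{1}{\bar{\mathsf{y}}_i^k-\bar{\mathsf{y}}_p^{k-1}}=\frac{\mathsf{a}_k-\mathsf{a}_{k+1}}{2},\qquad 1\le i\le k\le N-1,$$ subject to strict interlacing: $\bar{\mathsf{y}}^k\prec\bar{\mathsf{y}}^{k+1}$ with $\bar{\mathsf{y}}_i^k\ne\bar{\mathsf{y}}_j^{k+1}$ for all $1\le k\le N-1$, $1\le i\le k$, $1\le j\le k+1$. (Existence and uniqueness hold for every such $\mathbf{z}$, $\mathsf{a}$.) Effective Hamiltonian: with $\mathbf{y}^N=\mathbf{z}$ fixed and $\mathbf{Y}=(\mathbf{y}^1,\ldots,\mathbf{y}^{N-1})$ strictly interlacing, $$H_{\mathsf{a}}(\mathbf{Y})=\sum_{k=1}^{N-1}\Bigl[\sum_{1\le i<j\le k}\log(y_i^k-y_j^k)-\frac12\sum_{p=1}^k\sum_{q=1}^{k+1}\log|y_p^k-y_q^{k+1}|-\frac{\mathsf{a}_k-\mathsf{a}_{k+1}}{2}\sum_{i=1}^k y_i^k\Bigr].$$ Deformed discrete Gaussian Free Field on $\{\bar{\mathsf{y}}_i^k\}$: the centered Gaussian vector $\{\bar\zeta_i^k\}_{1\le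 i\le k\le N}$ with $\bar\zeta_i^N=0$ for all $i$ and with the remaining variables having joint density proportional to $$\exp\Bigl(-\frac12\sum_{i,k}\sum_{j,\ell}\bar\zeta_i^k\,\mathcal{H}_{(i,k),(j,\ell)}\,\bar\zeta_j^\ell\Bigr),\qquad \mathcal{H}_{(i,k),(j,\ell)}=\frac{\partial^2 H_{\mathsf{a}}}{\partial y_i^k\,\partial y_j^\ell}\Big|_{\mathbf{Y}=\bar{\mathsf{Y}}},$$ where $1\le i\le k\le N-1$ and $1\le j\le\ell\le N-1$. The matrix $\mathcal{H}$ is positive definite, so this is well defined. *)

(* Defs.v *)
From HB Require Import structures.
From mathcomp Require Import all_boot all_order all_algebra.
From mathcomp Require Import all_classical all_reals all_analysis.

Set Implicit Arguments.
Unset Strict Implicit.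
Unset Printing Implicit Defensive.

Import Order.TTheory GRing.Theory Num.Theory.
Import numFieldNormedType.Exports.

Local Open Scope classical_set_scope.
Local Open Scope ring_scope.

Section LebesgueTuple.
Context {R : realType}.

Definition cons_pair n (p : measurableTypeR R * n.-tuple R) : n.+1.-tuple R :=
  [tuple of p.1 :: p.2].

Let measurable_cons_pair n : measurable_fun setT (@cons_pair n).
Proof. exact: measurable_cons. Qed.

Let uncons n (t : n.+1.-tuple R) : measurableTypeR R * n.-tuple R :=
  (thead t, [tuple of behead t]).

Let measurable_uncons n : measurable_fun setT (@uncons n).
Proof.
apply/measurable_fun_pairP; split.
  exact: measurable_tnth.
exact: measurable_behead.
Qed.

Let cons_pairK n : cancel (@cons_pair n) (@uncons n).
Proof. by move=> [x t]; congr (_, _); apply/val_inj. Qed.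

Definition lebesgue_cons n (m : set (n.-tuple R) -> \bar R) :
    set (n.+1.-tuple R) -> \bar R :=
  pushforward (lebesgue_measure \x m)%E (@cons_pair n).

Section lebesgue_cons.
Context n (m : {sigma_finite_measure set (n.-tuple R) -> \bar R}).

Let measurable_preimage A :
  measurable A -> measurable (@cons_pair n @^-1` A).
Proof.
by move=> mA; rewrite -[X in measurable X]setTI; exact: measurable_cons_pair.
Qed.

Let lebesgue_cons0 : lebesgue_cons m set0 = 0%E.
Proof. by rewrite /lebesgue_cons /pushforward preimage_set0 measure0. Qed.

Let lebesgue_cons_ge0 A : (0 <= lebesgue_cons m A)%E.
Proof.
exact: (measure_ge0 ((lebesgue_measure \x m)%E : {measure set _ -> \bar R})).
Qed.

Let lebesgue_cons_sigma_additive : semi_sigma_additive (lebesgue_cons m).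
Proof.
move=> F mF tF mUF; rewrite /lebesgue_cons /pushforward preimage_bigcup.
apply: measure_semi_sigma_additive.
- by move=> i; exact: measurable_preimage.
- apply/trivIsetP => i j _ _ ij; rewrite -preimage_setI.
  by move/trivIsetP : tF => /(_ _ _ _ _ ij) ->//; rewrite preimage_set0.
- by rewrite -preimage_bigcup; exact: measurable_preimage.
Qed.

HB.instance Definition _ := isMeasure.Build _ _ _ (lebesgue_cons m)
  lebesgue_cons0 lebesgue_cons_ge0 lebesgue_cons_sigma_additive.

Let lebesgue_cons_sigma_finite : sigma_finite setT (lebesgue_cons m).
Proof.
have /sigma_finiteP[F [FT ndF Foo]] := sigma_finiteT (@lebesgue_measure R).
have /sigma_finiteP[G [GT ndG Goo]] := sigma_finiteT m.
exists (fun k => @uncons n @^-1` (F k `*` G k)) => [|k].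
  rewrite -preimage_bigcup (_ : \bigcup_k _ = setT) ?preimage_setT//.
  rewrite -setXTT FT GT predeqE => -[x y]; split.
    by move=> [i _ []/= ? ?]; split; exists i.
  move=> [/= [i _ Fix] [k _ Gky]]; exists (maxn i k) => //; split.
  - by move: x Fix; exact/subsetPset/ndF/leq_maxl.
  - by move: y Gky; exact/subsetPset/ndG/leq_maxr.
have [? ?] := Foo k; have [? ?] := Goo k; split.
  rewrite -[X in measurable X]setTI; apply: measurable_uncons => //.
  exact: measurableX.
rewrite /lebesgue_cons /pushforward -comp_preimage (_ : _ \o _ = id).
  by rewrite preimage_id product_measure1E// lte_mul_pinfty// ge0_fin_numE.
by apply/funext => x; exact: cons_pairK.
Qed.

HB.instance Definition _ := Measure_isSigmaFinite.Build _ _ _ (lebesgue_cons m)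
  lebesgue_cons_sigma_finite.

End lebesgue_cons.

(* Lebesgue measure on R^n. *)
Fixpoint lebesgue_tuple n : set (n.-tuple R) -> \bar R :=
  match n with
  | 0 => \d_([tuple] : 0.-tuple R)
  | m.+1 => lebesgue_cons (@lebesgue_tuple m)
  end.

Arguments lebesgue_tuple n : clear implicits.

Let lebesgue_tuple_packed n :
  exists m : {sigma_finite_measure set (n.-tuple R) -> \bar R},
    m = lebesgue_tuple n :> (set _ -> \bar R).
Proof.
elim: n => [|n [m mE]] /=; first by exists \d_([tuple] : 0.-tuple R).
by exists (lebesgue_cons m); rewrite -mE.
Qed.

Let lebesgue_tuple0 n : lebesgue_tuple n set0 = 0%E.
Proof. by have [m <-] := lebesgue_tuple_packed n; exact: measure0. Qed.

Let lebesgue_tuple_ge0 n A : (0 <= lebesgue_tuple n A)%E.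
Proof. by have [m <-] := lebesgue_tuple_packed n. Qed.

Let lebesgue_tuple_sigma_additive n : semi_sigma_additive (lebesgue_tuple n).
Proof.
by have [m <-] := lebesgue_tuple_packed n; exact: measure_semi_sigma_additive.
Qed.

HB.instance Definition _ n := isMeasure.Build _ _ _ (lebesgue_tuple n)
  (@lebesgue_tuple0 n) (@lebesgue_tuple_ge0 n)
  (@lebesgue_tuple_sigma_additive n).

Let lebesgue_tuple_sigma_finite n : sigma_finite setT (lebesgue_tuple n).
Proof. by have [m <-] := lebesgue_tuple_packed n; exact: sigma_finiteT. Qed.

HB.instance Definition _ n := Measure_isSigmaFinite.Build _ _ _
  (lebesgue_tuple n) (@lebesgue_tuple_sigma_finite n).

End LebesgueTuple.
Arguments lebesgue_tuple : clear implicits.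

(* An array with levels y^1, y^2, ... is listed level by level: y_i^k comes at
   position 1 + ... + (k-1) + (i-1), with k and i starting from 1. The levels
   1, ..., N-1 thus form an 'C(N, 2)-tuple Y, and appending the top row z of
   size N to Y gives the whole array. *)
Definition entry (R : realType) (s : seq R) (k i : nat) : R :=
  nth 0 s ('C(k, 2) + i.-1).

Section Corners.
Context {R : realType} {N : nat}.

Local Notation lower := ('C(N, 2).-tuple R).
Local Notation whole := (('C(N, 2) + N).-tuple R).

Definition full_array (z : N.-tuple R) (Y : lower) : whole := [tuple of Y ++ z].

(* u and w are indexed from 1. The inequalities also give u_1 >= ... >= u_k and
   w_1 >= ... >= w_(k+1). *)
Definition interlaces k (u w : nat -> R) : Prop :=
  forall i, (1 <= i <= k)%N -> w i.+1 <= u i <= w i.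

Definition interlacing_array (z : N.-tuple R) (Y : lower) : Prop :=
  let y := entry (full_array z Y) in
  forall k, (1 <= k < N)%N -> interlaces k (y k) (y k.+1).

Definition strictly_interlacing_array (z : N.-tuple R) (Y : lower) : Prop :=
  let y := entry (full_array z Y) in
  interlacing_array z Y /\
  forall k i j, (1 <= k < N)%N -> (1 <= i <= k)%N -> (1 <= j <= k.+1)%N ->
    y k i != y k.+1 j.

(* a_k - a_(k+1), with a indexed from 1. *)
Definition increment (a : N.-tuple R) (k : nat) : R :=
  nth 0 a k.-1 - nth 0 a k.

Definition corners_density (beta : R) (a z : N.-tuple R) (Y : lower) : R :=
  let y := entry (full_array z Y) in
  \1_[set Y' | interlacing_array z Y'] Y *
  (\prod_(1 <= k < N)
     ((\prod_(1 <= i < k.+1) \prod_(i.+1 <= j < k.+1)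
         (y k i - y k j) `^ (2 - beta)) *
      (\prod_(1 <= p < k.+1) \prod_(1 <= q < k.+2)
         `|y k p - y k.+1 q| `^ (beta / 2 - 1)))) *
  expR (\sum_(1 <= k < N) \sum_(1 <= i < k.+1) y k i * increment a k).

(* The lattice is the lower levels of the solution of this system. Since it
   exists and is unique, it is described by the system itself. *)
Definition deformed_lattice (a z : N.-tuple R) (Y : lower) : Prop :=
  let y := entry (full_array z Y) in
  strictly_interlacing_array z Y /\
  forall k i, (1 <= k < N)%N -> (1 <= i <= k)%N ->
    \sum_(1 <= j < k.+1 | j != i) (y k i - y k j)^-1
    - 2^-1 * (\sum_(1 <= q < k.+2) (y k i - y k.+1 q)^-1)
    - 2^-1 * (\sum_(1 <= p < k) (y k i - y k.-1 p)^-1)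
    = increment a k / 2.

Definition hamiltonian (a z : N.-tuple R) (Y : lower) : R :=
  let y := entry (full_array z Y) in
  \sum_(1 <= k < N)
    ((\sum_(1 <= i < k.+1) \sum_(i.+1 <= j < k.+1) ln (y k i - y k j))
     - 2^-1 * (\sum_(1 <= p < k.+1) \sum_(1 <= q < k.+2)
                 ln `|y k p - y k.+1 q|)
     - increment a k / 2 * (\sum_(1 <= i < k.+1) y k i)).

End Corners.

Definition row_of_tuple (R : realType) n (t : n.-tuple R) : 'rV[R]_n :=
  \row_i tnth t i.

Definition tuple_of_row (R : realType) n (v : 'rV[R]_n) : n.-tuple R :=
  [tuple v ord0 i | i < n].

Definition hessian (R : realType) n (f : n.-tuple R -> R) (x : n.-tuple R)
    : 'M[R]_n :=
  \matrix_(p, q)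
    'D_(delta_mx ord0 p) ('D_(delta_mx ord0 q) (f \o @tuple_of_row R n))
      (row_of_tuple x).

Definition gaussian_weight (R : realType) n (H : 'M[R]_n) (x : n.-tuple R)
    : R :=
  expR (- (2^-1 * \sum_p \sum_q tnth x p * H p q * tnth x q)).

Definition has_density_prop (R : realType) d (T : measurableType d)
    (P : probability T R) n (X : {RV P >-> n.-tuple R}) (f : n.-tuple R -> R) :=
  exists2 c : R, 0 < c &
    forall A : set (n.-tuple R), measurable A ->
      distribution P X A = (\int[lebesgue_tuple R n]_(x in A) (c * f x)%:E)%E.

Definition cvg_in_distribution (R : realType) (I : Type) (F : set_system I)
    (d : I -> measure_display) (T : forall b, measurableType (d b))
    (P : forall b, probability (T b) R)
    (d' : measure_display) (T' : measurableType d') (P' : probability T' R)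
    n (X : forall b, T b -> 'rV[R]_n) (X' : T' -> 'rV[R]_n) :=
  forall g : 'rV[R]_n -> R, continuous g -> bounded_fun g ->
    ('E_(P b)[g \o X b] @[b --> F] --> 'E_P'[g \o X'])%E.

(* Main.v *)
Require Import Defs.
From mathcomp Require Import all_boot all_order all_algebra.
From mathcomp Require Import all_classical all_reals all_analysis.
From mathcomp Require Import measurable_realfun ring lra zify.

(** The proof is Laplace's method. For beta > 2 the density of the lower levels
    is, up to a constant,
      1_{strictly interlacing} exp(drift - (beta - 2) energy),
    where [energy] is the Hamiltonian and [drift] is a linear function of the
    array ([corners_density_ordered]). After the change of variables
    Y = ybar + x / sqrt beta the exponent tends to a constant minus one half of
    the Hessian form of the energy at the lattice, which is the exponent of the
    Gaussian field. Two facts about the energy justify the passage to the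
    limit: the lattice, which is given only as a critical point, is the unique
    global minimum, and the Hessian is positive definite there.

    Both come from the convexity of the energy on the convex set of strictly
    interlacing arrays. Convexity is not visible term by term, because the
    repulsion inside a level enters with the concave terms log (y_i - y_j).
    Give half of the repulsion inside each level to the level above it and half
    to the level below it. The part of the energy that involves two consecutive
    levels u and w, of k and k + 1 points, is then
      1/2 (sum log (u_i - u_j) + sum log (w_i - w_j) - sum log |u_p - w_q|),
    which is 1/2 log |det M| for the Cauchy matrix M with entries 1/(u_p - w_q),
    completed by a row of ones. Its second derivative in a direction (xi, eta)
    is 1/2 (tr(M^-1 M'') - tr((M^-1 M')^2)). Interlacing makes M orthogonal up
    to positive scalings alpha_p of the rows and beta_q of the columns. Hence
    the first trace is twice
      S = sum_(p,q) alpha_p beta_q (xi_p - eta_q)^2 / (u_p - w_q)^4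
    and the second one is at most S, by the Cauchy-Schwarz and Bessel
    inequalities, so that the second derivative is at least S / 2. This is
    [cauchy_form_ge]; the proof verifies the trace formula by elementary sums
    instead of differentiating determinants. Since the top level is fixed, the
    pieces add up to the Hessian form ([qform_levels]), and a direction that
    vanishes on the top level is controlled level by level from the top
    ([qform_coercive]).

    Positive definiteness gives a uniform second order expansion near the
    lattice ([energy_taylor2]), and convexity says that the energy does not
    decrease along rays from the lattice ([energy_ray_nondecreasing]), so that
    it stays above its minimum by a fixed amount away from the lattice. With
    these two estimates [laplace] is dominated convergence near the lattice and
    an exponentially small contribution elsewhere. The normalising constants
    are never computed: each of them is the inverse of the integral of the
    corresponding weight, and these integrals converge like all the others
    ([cvg_normalised]). *)

Set Implicit Arguments.
Unset Strict Implicit.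
Unset Printing Implicit Defensive.

Import Order.TTheory GRing.Theory Num.Theory.
Import numFieldNormedType.Exports.

Local Open Scope classical_set_scope.
Local Open Scope ring_scope.

(** * Interpolation weights of interlacing points *)

Section Weights.
Context {R : realFieldType} (k : nat) (u w : nat -> R).
Hypothesis uw : forall i, (i < k)%N -> w i.+1 < u i < w i.

Lemma interlacing_decr i j : (i < j <= k)%N -> w j < w i.
Proof.
elim: j => // j IH /andP[ij jk]; have /andP[l r] := uw jk.
move: ij; rewrite ltnS leq_eqVlt => /orP[/eqP->|ij]; first exact: lt_trans r.
by apply: lt_trans (IH _); [exact: lt_trans r | rewrite ij ltnW].
Qed.

Lemma interlacing_inj i j : i != j -> (i <= k)%N -> (j <= k)%N -> w i != w j.
Proof.
case: (ltngtP i j) => // ij _ ik jk; first by rewrite gt_eqF// interlacing_decr// ?ij.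
by rewrite lt_eqF// interlacing_decr// ?ij.
Qed.

(** The residue at w_q of the rational function prod (X - u_p) / prod (X - w_q),
    with each point of u paired to a point of w on the same side of w_q: under
    interlacing all the factors are positive. *)
Definition interp_weight (q : 'I_k.+1) : R :=
  \prod_(p < k) ((w q - u p) / (w q - w (lift q p))).

Lemma interp_weight_gt0 q : 0 < interp_weight q.
Proof.
apply: prodr_gt0 => p _; have /andP[l r] := uw (ltn_ord p).
rewrite /= /bump; case: leqP => qp /=.
  have wq : w p <= w q.
    move: qp; rewrite leq_eqVlt => /orP[/eqP->//|qp].
    by rewrite ltW// interlacing_decr// qp ltnW.
  rewrite divr_gt0// subr_gt0.
    exact: lt_le_trans wq.
  by apply: lt_le_trans wq; exact: lt_trans r.
have wq : w q <= w p.+1.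
  move: qp; rewrite leq_eqVlt => /orP[/eqP->//|qp].
  by rewrite ltW// interlacing_decr// qp -ltnS ltn_ord.
rewrite add0n -mulrNN -invrN !opprB divr_gt0// subr_gt0.
  exact: le_lt_trans wq l.
by apply: le_lt_trans wq _; exact: lt_trans r.
Qed.

(** Lagrange interpolation of prod (X - u_p), of degree k, at the k + 1 points of
    w. The two identities that follow are its leading coefficient and its value
    at the roots u_p. *)
Lemma interp_weight_poly :
  \prod_(p < k) ('X - (u p)%:P) =
  \sum_(q < k.+1) interp_weight q *: \prod_(p < k) ('X - (w (lift q p))%:P).
Proof.
have sz (v : 'I_k -> R) : size (\prod_(p < k) ('X - (v p)%:P)) = k.+1.
  by rewrite size_prod_XsubC /index_enum -enumT size_enum_ord.
apply/eqP; rewrite -subr_eq0; apply/eqP.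
set D := _ - _.
apply: (@roots_geq_poly_eq0 _ D [seq w q | q : 'I_k.+1]).
- apply/allP => _ /mapP[q _ ->]; rewrite rootE /D hornerD hornerN.
  rewrite horner_sum (bigD1 q)//= [\sum_(_ < _ | _) _]big1 => [|r rq].
    rewrite addr0 hornerZ !horner_prod /interp_weight -big_split/=.
    rewrite subr_eq0; apply/eqP/eq_bigr => p _.
    rewrite !hornerXsubC mulfVK// subr_eq0.
    by rewrite interlacing_inj ?neq_lift ?leq_ord// -ltnS (ltn_ord (lift q p)).
  rewrite hornerZ horner_prod; apply/eqP; rewrite mulf_eq0; apply/orP; right.
  have [s qs] : exists s, q = lift r s.
    by have := unlift_some rq => -[s ->]; exists s.
  by rewrite (bigD1 s)//= hornerXsubC qs subrr mul0r.
- rewrite map_inj_in_uniq ?enum_uniq// => q r _ _ wqr; apply/val_inj.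
  by apply/eqP; apply/negPn/negP => /interlacing_inj; rewrite wqr eqxx !leq_ord => /(_ isT isT).
- rewrite size_map size_enum_ord (leq_trans (size_polyD _ _))// geq_max.
  rewrite sz leqnn size_polyN (leq_trans (size_sum _ _ _))//.
  apply/bigmax_leqP => q _; rewrite (leq_trans (size_scale_leq _ _))//.
  by rewrite (sz (fun p => w (lift q p))).
Qed.

Lemma sum_interp_weight : \sum_(q < k.+1) interp_weight q = 1.
Proof.
have cf (v : 'I_k -> R) : (\prod_(p < k) ('X - (v p)%:P))`_k = 1.
  have := monic_prod_XsubC (index_enum 'I_k) predT v => /monicP.
  by rewrite lead_coefE size_prod_XsubC /index_enum -enumT size_enum_ord.
have := congr1 (coefp k) interp_weight_poly; rewrite /= cf coef_sum => ->.
by apply: eq_bigr => q _; rewrite coefZ (cf (fun p => w (lift q p))) mulr1.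
Qed.

Lemma sum_interp_weight_cauchy (i : 'I_k) :
  \sum_(q < k.+1) interp_weight q / (u i - w q) = 0.
Proof.
have uwN (q : 'I_k.+1) : u i - w q != 0.
  have /andP[l r] := uw (ltn_ord i).
  rewrite subr_eq0; case: (ltngtP q i) => [qi|qi|->].
  - by rewrite lt_eqF// (lt_trans r)// interlacing_decr// qi ltnW.
  - move: qi; rewrite leq_eqVlt => /orP[/eqP<-|qi]; first by rewrite gt_eqF.
    rewrite gt_eqF// (lt_trans _ l)// interlacing_decr// qi.
    by rewrite -ltnS ltn_ord.
  - by rewrite lt_eqF.
have := congr1 (horner^~ (u i)) interp_weight_poly.
rewrite horner_prod (bigD1 i)//= hornerXsubC subrr mul0r horner_sum => e.
transitivity ((\prod_(q < k.+1) (u i - w q))^-1 *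
  \sum_(q < k.+1) (interp_weight q *:
    \prod_(p < k) ('X - (w (lift q p))%:P)).[u i]); last by rewrite -e mulr0.
rewrite mulr_sumr; apply: eq_bigr => q _.
rewrite hornerZ horner_prod (bigD1_ord q)//=.
under [X in _ = _ * (_ * X)]eq_bigr do rewrite hornerXsubC.
have P0 : \prod_(p < k) (u i - w (lift q p)) != 0.
  by apply/prodf_neq0 => p _; exact: uwN.
have := uwN q; move: P0 => /=.
set P := \prod_(_ < _) _; set b := interp_weight _.
by move=> h1 h2; field; rewrite h1 h2.
Qed.
End Weights.

(** * Positivity of the second variation of a Cauchy determinant *)

(** Throughout this section M is the square matrix with rows K p, for p < k, and
    a last row of ones. The hypotheses on b say that the rows of M are
    orthogonal for the weights b; [al p] is the inverse of the squared norm of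
    row p, and the last row has norm 1. *)
Section CauchyForm.
Context {R : realFieldType} (k : nat).
Variables (u : 'I_k -> R) (w b : 'I_k.+1 -> R).
Hypothesis u_inj : injective u.
Hypothesis w_inj : injective w.
Hypothesis uw : forall p q, u p != w q.
Hypothesis b_gt0 : forall q, 0 < b q.
Hypothesis sum_b : \sum_q b q = 1.
Hypothesis sum_bK : forall p, \sum_q b q / (u p - w q) = 0.

Let K p q := (u p - w q)^-1.
Let S p := \sum_q b q * K p q ^+ 2.
Let al p := (S p)^-1.

Let K0 p q : K p q != 0. Proof. by rewrite invr_eq0 subr_eq0 uw. Qed.

Let S_gt0 p : 0 < S p.
Proof.
rewrite /S (bigD1 ord0)//= ltr_wpDr//.
  by apply: sumr_ge0 => q _; rewrite mulr_ge0 ?sqr_ge0 ?ltW.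
by rewrite mulr_gt0 ?exprn_even_gt0 ?K0.
Qed.

Let al_gt0 p : 0 < al p. Proof. by rewrite invr_gt0. Qed.

Let alS p : al p * S p = 1. Proof. by rewrite mulVf ?gt_eqF. Qed.

Let du p p' : p != p' -> u p - u p' != 0.
Proof. by rewrite subr_eq0 (inj_eq u_inj). Qed.
Let dw q r : q != r -> w q - w r != 0.
Proof. by rewrite subr_eq0 (inj_eq w_inj). Qed.

Let KKu p p' q : p != p' -> K p q * K p' q = (K p' q - K p q) / (u p - u p').
Proof.
move=> /du h; rewrite /K; field.
by rewrite h !subr_eq0 !uw.
Qed.

Let KKw p q r : q != r -> K p q * K p r = (K p q - K p r) / (w q - w r).
Proof.
move=> /dw h; rewrite /K; field.
by rewrite h !subr_eq0 !uw.
Qed.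

Let row_orth p p' :
  al p' * (\sum_q b q * K p q * K p' q) = (p == p')%:R.
Proof.
have [<-|ne] := eqVneq p p'.
  by rewrite -[RHS](alS p); congr (_ * _); apply: eq_bigr => q _; ring.
rewrite [X in _ * X](_ : _ = (u p - u p')^-1 *
   (\sum_q b q * K p' q - \sum_q b q * K p q)).
  by rewrite !sum_bK subrr !mulr0.
rewrite -sumrB mulr_sumr; apply: eq_bigr => q _.
transitivity (b q * (K p q * K p' q)); first ring.
  by rewrite (KKu _ ne); ring.
Qed.

(** A one-sided inverse of a square matrix is two-sided, so that the
    orthogonality of the rows of M gives that of its columns. The term -1 is the
    contribution of the row of ones. *)
Let col_orth q r :
  \sum_p al p * K p q * K p r = (q == r)%:R / b q - 1.
Proof.
(* The row of ones is put first, where big_ord_recl splits it off. *)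
pose A := \matrix_(i < k.+1, j < k.+1)
  (if unlift ord0 i is Some p then K p j else 1).
pose B := \matrix_(j < k.+1, i < k.+1)
  (b j * (if unlift ord0 i is Some p then al p * K p j else 1)).
have AB : A *m B = 1%:M.
  apply/matrixP => i i'; rewrite !mxE.
  case: (unliftP ord0 i) => [p|] ->; case: (unliftP ord0 i') => [p'|] ->.
  - rewrite (inj_eq lift_inj) -row_orth mulr_sumr; apply: eq_bigr => q' _.
    by rewrite !mxE !liftK; ring.
  - rewrite (_ : lift ord0 p == ord0 = false)//.
    transitivity (\sum_q' b q' / (u p - w q')); last exact: sum_bK.
    by apply: eq_bigr => q' _; rewrite !mxE liftK unlift_none /K; ring.
  - rewrite (_ : ord0 == lift ord0 p' = false)//.
    transitivity (al p' * \sum_q' b q' / (u p' - w q')).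
      rewrite mulr_sumr.
    by apply: eq_bigr => q' _; rewrite !mxE liftK unlift_none /K; ring.
    by rewrite sum_bK mulr0.
  - rewrite eqxx -sum_b.
    by apply: eq_bigr => q' _; rewrite !mxE unlift_none; ring.
have /matrixP/(_ q r) := mulmx1C AB.
rewrite !mxE big_ord_recl !mxE unlift_none => <-.
rewrite mulr1 mulrDl mulr1 divff ?gt_eqF// addrAC subrr add0r mulr_suml.
apply: eq_bigr => p _; rewrite !mxE liftK.
by field; rewrite gt_eqF.
Qed.

Let col2 q r : q != r ->
  \sum_p al p * K p q ^+ 2 * K p r = (b q * (w q - w r))^-1.
Proof.
move=> qr; have := dw qr; have h := negbT (gt_eqF (b_gt0 q)); move=> h'.
transitivity ((w q - w r)^-1 *
   (\sum_p al p * K p q * K p q - \sum_p al p * K p q * K p r)).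
  rewrite -sumrB mulr_sumr; apply: eq_bigr => p _.
  transitivity (al p * K p q * (K p q * K p r)); first ring.
  by rewrite (KKw _ qr); ring.
by rewrite !col_orth eqxx (negbTE qr) mulr1n mulr0n; field; rewrite h h'.
Qed.

Let row2 p p' : p != p' ->
  \sum_q b q * K p q ^+ 2 * K p' q = - (S p / (u p - u p')).
Proof.
move=> pp'; transitivity ((u p - u p')^-1 *
   (\sum_q b q * K p q * K p' q - \sum_q b q * K p q * K p q)).
  rewrite -sumrB mulr_sumr; apply: eq_bigr => q _.
  transitivity (b q * K p q * (K p q * K p' q)); first ring.
  by rewrite (KKu _ pp'); ring.
have /eqP := row_orth p p'.
rewrite (negbTE pp') mulf_eq0 gt_eqF//= => /eqP->.
rewrite sub0r mulrN mulrC; congr (- (_ / _)).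
by apply: eq_bigr => q _; ring.
Qed.

(** Compares the second coefficients, at the pole w_r, of the expansions of
    sum_q b_q/(X - w_q) and of its inverse, whose residues at the u_p are
    - al p. *)
Let pole r : \sum_(q | q != r) b q / (w r - w q) =
  - (b r ^+ 2 * \sum_p al p * K p r ^+ 3).
Proof.
transitivity (\sum_(q | q != r) b r * b q * \sum_p al p * K p r ^+ 2 * K p q).
  apply: eq_bigr => q qr; rewrite col2 1?eq_sym//.
  have h := negbT (gt_eqF (b_gt0 r)); field.
  by rewrite h dw// eq_sym.
under eq_bigr do rewrite mulr_sumr.
rewrite exchange_big/= mulr_sumr -sumrN; apply: eq_bigr => p _.
rewrite (_ : \sum_(_ | _) _ = b r * al p * K p r ^+ 2 *
    \sum_(q | q != r) b q * K p q); last first.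
  by rewrite mulr_sumr; apply: eq_bigr => q _; ring.
have /eqP := sum_bK p.
rewrite (bigD1 r)//= addrC addr_eq0 => /eqP.
by rewrite -/(K p r) => ->; ring.
Qed.

(** The coefficients of tr((M^-1 M')^2) as a quadratic form in the differences
    xi_p - eta_q. Only their sums over two of the four indices are needed, and
    these have closed forms. *)
Let c p p' q r :=
  al p * al p' * b q * b r * K p q ^+ 2 * K p' q * K p' r ^+ 2 * K p r.

Let marg_uu p p' : p != p' ->
  \sum_q \sum_r c p p' q r = - ((u p - u p') ^+ 2)^-1.
Proof.
move=> pp'.
transitivity (al p * al p' * (\sum_q b q * K p q ^+ 2 * K p' q) *
    (\sum_r b r * K p' r ^+ 2 * K p r)).
  rewrite -!mulrA big_distrlr/= !mulr_sumr; apply: eq_bigr => q _.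
  by rewrite !mulr_sumr; apply: eq_bigr => r _; rewrite /c; ring.
have p'p : p' != p by rewrite eq_sym.
rewrite (row2 pp') (row2 p'p) /al.
have h := negbT (gt_eqF (S_gt0 p)); have h' := negbT (gt_eqF (S_gt0 p')).
by field; rewrite h h' !du.
Qed.

Let marg_ww q r : q != r ->
  \sum_p \sum_p' c p p' q r = - ((w q - w r) ^+ 2)^-1.
Proof.
move=> qr.
transitivity (b q * b r * (\sum_p al p * K p q ^+ 2 * K p r) *
    (\sum_p' al p' * K p' r ^+ 2 * K p' q)).
  rewrite -!mulrA big_distrlr/= !mulr_sumr; apply: eq_bigr => p _.
  by rewrite !mulr_sumr; apply: eq_bigr => p' _; rewrite /c; ring.
have rq : r != q by rewrite eq_sym.
rewrite (col2 qr) (col2 rq).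
have h := negbT (gt_eqF (b_gt0 q)); have h' := negbT (gt_eqF (b_gt0 r)).
by field; rewrite h h' !dw.
Qed.

Let marg_uw p r : \sum_p' \sum_q c p p' q r =
  2 * (al p * b r * K p r ^+ 4) - K p r ^+ 2.
Proof.
have hr := negbT (gt_eqF (b_gt0 r)).
set T := \sum_p al p * K p r ^+ 3.
transitivity (\sum_q al p * b r * K p r * b q * K p q ^+ 2 *
    \sum_p' al p' * K p' r ^+ 2 * K p' q).
  rewrite exchange_big; apply: eq_bigr => q _; rewrite mulr_sumr.
  by apply: eq_bigr => p' _; rewrite /c; ring.
rewrite (bigD1 r)//=.
rewrite (_ : \sum_p' al p' * K p' r ^+ 2 * K p' r = T); last first.
  by apply: eq_bigr => ? _; ring.
transitivity (al p * b r ^+ 2 * K p r ^+ 3 * T + al p * K p r *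
   (K p r ^+ 2 * (\sum_(q | q != r) b q / (w r - w q))
    - K p r ^+ 2 * (\sum_(q | q != r) b q * K p q)
    - K p r * (\sum_(q | q != r) b q * K p q ^+ 2))).
  congr (_ + _); first ring.
  rewrite !mulr_sumr -!sumrB mulr_sumr; apply: eq_bigr => q qr.
  have rq : r != q by rewrite eq_sym.
  rewrite (col2 rq).
  have := uw p q; have := uw p r.
  rewrite -subr_eq0 => h1; rewrite -subr_eq0 => h2; rewrite /K.
  by field; rewrite h1 h2 (dw rq) hr.
have /eqP := sum_bK p; rewrite (bigD1 r)//= addrC addr_eq0 => /eqP.
rewrite -/(K p r) => ->.
have : S p = S p by []; rewrite {1}/S (bigD1 r)//= => /eqP.
rewrite addrC eq_sym -subr_eq => /eqP <-.
rewrite pole -/T; have := alS p; move: (al p) (S p) => x y xy.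
transitivity (2 * (x * b r * K p r ^+ 4) - (x * y) * K p r ^+ 2); first ring.
by rewrite xy mul1r.
Qed.

Variables (xi : 'I_k -> R) (eta : 'I_k.+1 -> R).

Let y p p' := \sum_q b q * (K p q ^+ 2 * (xi p - eta q)) * K p' q.

(** The products of differences are turned into squares by
    2 (x - y)(x' - y') = (x - y')^2 + (x' - y)^2 - (x - x')^2 - (y - y')^2,
    after which each square sees one of the sums of [c] over two indices. *)
Let trace : \sum_p \sum_p' al p * al p' * (y p p' * y p' p) =
   \sum_p \sum_q (2 * (al p * b q * K p q ^+ 4) - K p q ^+ 2)
       * (xi p - eta q) ^+ 2
   + 2^-1 * (\sum_p \sum_(p' | p' != p) ((xi p - xi p') / (u p - u p')) ^+ 2)
   + 2^-1 * (\sum_q \sum_(r | r != q) ((eta q - eta r) / (w q - w r)) ^+ 2).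
Proof.
transitivity (\sum_p \sum_p' \sum_q \sum_r
    c p p' q r * ((xi p - eta q) * (xi p' - eta r))).
  apply: eq_bigr => p _; apply: eq_bigr => p' _.
  rewrite /y big_distrlr/= mulr_sumr; apply: eq_bigr => q _.
  by rewrite mulr_sumr; apply: eq_bigr => r _; rewrite /c; ring.
pose F1 := \sum_p \sum_p' \sum_q \sum_r c p p' q r * (xi p - eta r) ^+ 2.
pose F2 := \sum_p \sum_p' \sum_q \sum_r c p p' q r * (xi p' - eta q) ^+ 2.
pose F3 := \sum_p \sum_p' \sum_q \sum_r c p p' q r * (xi p - xi p') ^+ 2.
pose F4 := \sum_p \sum_p' \sum_q \sum_r c p p' q r * (eta q - eta r) ^+ 2.
transitivity (2^-1 * (F1 + F2 - F3 - F4)).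
  rewrite /F1 /F2 /F3 /F4 -big_split/= -!sumrB mulr_sumr.
  apply: eq_bigr => p _; rewrite -big_split/= -!sumrB mulr_sumr.
  apply: eq_bigr => p' _; rewrite -big_split/= -!sumrB mulr_sumr.
  apply: eq_bigr => q _; rewrite -big_split/= -!sumrB mulr_sumr.
  by apply: eq_bigr => r _ /=; field.
have F21 : F2 = F1.
  rewrite /F2 exchange_big; apply: eq_bigr => p _; apply: eq_bigr => p' _.
  rewrite exchange_big; apply: eq_bigr => q _; apply: eq_bigr => r _.
  by rewrite /c; ring.
rewrite F21; have -> : F1 = \sum_p \sum_q (2 * (al p * b q * K p q ^+ 4) - K p q ^+ 2)
       * (xi p - eta q) ^+ 2.
  apply: eq_bigr => p _.
  transitivity (\sum_r \sum_p' \sum_q c p p' q r * (xi p - eta r) ^+ 2).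
    rewrite [RHS]exchange_big; apply: eq_bigr => p' _.
    by rewrite [RHS]exchange_big.
  apply: eq_bigr => r _; rewrite -marg_uw mulr_suml.
  by apply: eq_bigr => p' _; rewrite mulr_suml.
have -> : F3 =
    - (\sum_p \sum_(p' | p' != p) ((xi p - xi p') / (u p - u p')) ^+ 2).
  rewrite -sumrN; apply: eq_bigr => p _; rewrite (bigD1 p)//=.
  rewrite big1 => [|q _]; last by rewrite big1// => r _; rewrite subrr; ring.
  rewrite add0r -sumrN; apply: eq_bigr => p' pp'.
  rewrite exprMn exprVn -mulrN -marg_uu 1?eq_sym// mulr_sumr.
  by apply: eq_bigr => q _; rewrite mulr_sumr; apply: eq_bigr => r _; ring.
have -> : F4 =
    - (\sum_q \sum_(r | r != q) ((eta q - eta r) / (w q - w r)) ^+ 2).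
  transitivity (\sum_q \sum_r \sum_p \sum_p'
      c p p' q r * (eta q - eta r) ^+ 2).
    rewrite /F4; under eq_bigr do rewrite exchange_big /=.
    rewrite exchange_big; apply: eq_bigr => q _ /=.
    under eq_bigr do rewrite exchange_big /=.
    by rewrite exchange_big.
  rewrite -sumrN; apply: eq_bigr => q _; rewrite (bigD1 q)//=.
  rewrite big1 => [|p _]; last by rewrite big1// => p' _; rewrite subrr; ring.
  rewrite add0r -sumrN; apply: eq_bigr => r qr.
  rewrite exprMn exprVn -mulrN -marg_ww 1?eq_sym// mulr_sumr.
  by apply: eq_bigr => p _; rewrite mulr_sumr; apply: eq_bigr => p' _; ring.
by field.
Qed.

(** Bessel's inequality for the rows of M, which are orthogonal for b. *)
Let bessel (v : 'I_k.+1 -> R) :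
  \sum_p al p * (\sum_q b q * v q * K p q) ^+ 2 <= \sum_q b q * v q ^+ 2.
Proof.
pose m p := \sum_q b q * v q * K p q.
pose g q := \sum_p al p * m p * K p q.
have e1 : \sum_q b q * v q * g q = \sum_p al p * m p ^+ 2.
  under eq_bigr do rewrite mulr_sumr.
  rewrite exchange_big; apply: eq_bigr => p _.
  transitivity (al p * m p * \sum_q b q * v q * K p q).
    by rewrite [RHS]mulr_sumr; apply: eq_bigr => q _; ring.
  by rewrite -/(m p); ring.
have e2 : \sum_q b q * g q ^+ 2 = \sum_p al p * m p ^+ 2.
  transitivity (\sum_q \sum_p \sum_p' b q * (al p * m p * K p q *
      (al p' * m p' * K p' q))).
    apply: eq_bigr => q _; rewrite expr2 big_distrlr/= mulr_sumr.
    by apply: eq_bigr => p _; rewrite mulr_sumr.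
  rewrite exchange_big; apply: eq_bigr => p _.
  rewrite exchange_big (bigD1 p)//= [X in _ + X]big1/= => [|p' pp'].
    rewrite addr0 -[RHS]mulr1.
    have := row_orth p p; rewrite eqxx mulr1n => <-.
    rewrite !mulrA [RHS]mulr_sumr; apply: eq_bigr => q _.
    by rewrite mulrA; ring.
  transitivity (al p * m p * m p' * (al p' * \sum_q b q * K p q * K p' q)).
    by rewrite mulrA [RHS]mulr_sumr; apply: eq_bigr => q _; ring.
  by rewrite row_orth eq_sym (negbTE pp') mulr0.
have : 0 <= \sum_q b q * (v q - g q) ^+ 2.
  by apply: sumr_ge0 => q _; rewrite mulr_ge0 ?sqr_ge0 ?ltW.
rewrite (_ : \sum_q _ = \sum_q b q * v q ^+ 2 - 2 * (\sum_q b q * v q * g q)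
  + \sum_q b q * g q ^+ 2).
  by rewrite e1 e2 -/m; lra.
rewrite mulr_sumr -sumrB -big_split; apply: eq_bigr => q _ /=; ring.
Qed.

(** The right-hand side is the second derivative of log |det M| in the direction
    (xi, eta), by Cauchy's formula for det M. By
    [trace] it equals twice the left-hand side minus tr((M^-1 M')^2), and the
    latter is at most the left-hand side. *)
Lemma cauchy_form_ge :
  \sum_p \sum_q b q / (S p * (u p - w q) ^+ 4) * (xi p - eta q) ^+ 2 <=
  \sum_p \sum_q ((xi p - eta q) / (u p - w q)) ^+ 2
   - 2^-1 * (\sum_p \sum_(p' | p' != p) ((xi p - xi p') / (u p - u p')) ^+ 2)
   - 2^-1 * (\sum_q \sum_(r | r != q) ((eta q - eta r) / (w q - w r)) ^+ 2).
Proof.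
set E := (X in X <= _).
have EE : E = \sum_p \sum_q al p * b q * K p q ^+ 4 * (xi p - eta q) ^+ 2.
  rewrite /E; apply: eq_bigr => p _; apply: eq_bigr => q _;
     by rewrite /al /K invfM exprVn; ring.
(* The matrix with entries y p p' is not symmetric in general: its squared trace
   is bounded by its squared Frobenius norm, for the weights al. *)
have amgm : \sum_p \sum_p' al p * al p' * (y p p' * y p' p) <=
     \sum_p \sum_p' al p * al p' * y p p' ^+ 2.
  have h : 0 <= \sum_p \sum_p' al p * al p' * (y p p' - y p' p) ^+ 2.
    apply: sumr_ge0 => p _; apply: sumr_ge0 => p' _.
    by apply: mulr_ge0; [apply: mulr_ge0; exact: ltW|exact: sqr_ge0].
  have e1 : \sum_p \sum_p' al p * al p' * y p' p ^+ 2 =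
      \sum_p \sum_p' al p * al p' * y p p' ^+ 2.
    rewrite exchange_big; apply: eq_bigr => p _.
    by apply: eq_bigr => p' _; rewrite (mulrC (al p)).
  have e2 : \sum_p \sum_p' al p * al p' * (y p p' - y p' p) ^+ 2 =
     \sum_p \sum_p' al p * al p' * y p p' ^+ 2
     + \sum_p \sum_p' al p * al p' * y p' p ^+ 2
     - 2 * \sum_p \sum_p' al p * al p' * (y p p' * y p' p).
    rewrite mulr_sumr -big_split -sumrB; apply: eq_bigr => p _ /=.
    rewrite mulr_sumr -big_split -sumrB; apply: eq_bigr => p' _ /=; ring.
  by rewrite e2 e1 in h; lra.
have bess : \sum_p \sum_p' al p * al p' * y p p' ^+ 2 <= E.
  rewrite EE; apply: ler_sum => p _.
  have -> : \sum_p' al p * al p' * y p p' ^+ 2 =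
      al p * \sum_p' al p' * y p p' ^+ 2.
    by rewrite [RHS]mulr_sumr; apply: eq_bigr => p' _; ring.
  have -> : \sum_q al p * b q * K p q ^+ 4 * (xi p - eta q) ^+ 2 =
      al p * \sum_q b q * (K p q ^+ 2 * (xi p - eta q)) ^+ 2.
    by rewrite [RHS]mulr_sumr; apply: eq_bigr => q _; ring.
  by rewrite ler_pM2l//; exact: bessel.
have spl : \sum_p \sum_q (2 * (al p * b q * K p q ^+ 4) - K p q ^+ 2)
       * (xi p - eta q) ^+ 2 =
   2 * E - \sum_p \sum_q ((xi p - eta q) / (u p - w q)) ^+ 2.
  rewrite EE mulr_sumr -sumrB; apply: eq_bigr => p _.
  rewrite mulr_sumr -sumrB; apply: eq_bigr => q _.
  by rewrite exprMn -/(K p q); ring.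
by have := trace; rewrite spl => t; rewrite t in amgm; lra.
Qed.
End CauchyForm.

(** * Interlacing arrays and the Hessian form *)

(** A link is a pair of positions (level, index) of an array that interact. Links
    are oriented so that the difference of the two entries is positive when the
    array interlaces; this removes the absolute values and makes strict
    interlacing a finite system of linear inequalities. *)
Definition link : Type := (nat * nat) * (nat * nat).

Definition level_links (k : nat) : seq link :=
  flatten [seq [seq ((k, i), (k, j)) | j <- index_iota i.+1 k.+1]
             | i <- index_iota 1 k.+1].

Definition cross_link (k p q : nat) : link :=
  if (q <= p)%N then ((k.+1, q), (k, p)) else ((k, p), (k.+1, q)).

Definition cross_links (k : nat) : seq link :=
  flatten [seq [seq cross_link k p q | q <- index_iota 1 k.+2]
             | p <- index_iota 1 k.+1].

Definition links (N : nat) : seq link :=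
  flatten [seq level_links k ++ cross_links k | k <- index_iota 1 N].

Section Links.
Context {R : realFieldType}.
Implicit Types (y x : nat -> nat -> R) (e : link).

Definition gap y e : R := y e.1.1 e.1.2 - y e.2.1 e.2.2.

(** The exponents 2 - beta and beta/2 - 1 of the density are in the ratio of 1 to
    -1/2. *)
Definition charge e : R := if e.1.1 == e.2.1 then 1 else - 2^-1.

Lemma charge_cross k l i j : k != l -> charge ((k, i), (l, j)) = - 2^-1.
Proof. by rewrite /charge/= => /negbTE->. Qed.

Definition swap e : link := (e.2, e.1).

Lemma sum_links N (h : link -> R) : (forall e, h (swap e) = h e) ->
  \sum_(e <- links N) charge e * h e =
  \sum_(1 <= k < N)
    ((\sum_(1 <= i < k.+1) \sum_(i.+1 <= j < k.+1) h ((k, i), (k, j)))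
     - 2^-1 * (\sum_(1 <= p < k.+1) \sum_(1 <= q < k.+2) h ((k, p), (k.+1, q)))).
Proof.
move=> hsym; rewrite /links big_flatten big_map; apply: eq_bigr => k _.
rewrite big_cat !big_flatten !big_map mulr_sumr -sumrN; congr (_ + _).
  apply: eq_bigr => i _; rewrite big_map; apply: eq_bigr => j _.
  by rewrite /charge eqxx mul1r.
apply: eq_bigr => p _. rewrite big_map mulr_sumr -sumrN.
apply: eq_bigr => q _; rewrite /cross_link; case: ifP => _.
  by rewrite charge_cross ?mulNr -?[h (k, _, _)]hsym// eq_sym neq_ltn ltnSn.
by rewrite charge_cross ?mulNr// neq_ltn ltnSn.
Qed.

Lemma level_link_in N k i j : (0 < k < N)%N -> (0 < i < j)%N -> (j <= k)%N ->
  ((k, i), (k, j)) \in links N.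
Proof.
move=> kN ij jk; apply/flattenP.
exists (level_links k ++ cross_links k).
  by apply/mapP; exists k => //; rewrite mem_index_iota.
rewrite mem_cat; apply/orP; left; apply/flattenP.
exists [seq ((k, i), (k, j)) | j <- index_iota i.+1 k.+1].
  by apply/mapP; exists i => //; rewrite mem_index_iota; lia.
by apply/mapP; exists j => //; rewrite mem_index_iota; lia.
Qed.

Lemma cross_link_in N k p q : (0 < k < N)%N -> (0 < p <= k)%N ->
  (0 < q <= k.+1)%N -> cross_link k p q \in links N.
Proof.
move=> kN ij jk; apply/flattenP.
exists (level_links k ++ cross_links k).
  by apply/mapP; exists k => //; rewrite mem_index_iota.
rewrite mem_cat; apply/orP; right; apply/flattenP.
exists [seq cross_link k p j | j <- index_iota 1 k.+2].
  by apply/mapP; exists p => //; rewrite mem_index_iota; lia.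
by apply/mapP; exists q => //; rewrite mem_index_iota; lia.
Qed.

Lemma linksP N e : e \in links N ->
  exists k, (0 < k < N)%N /\
   ((exists i j, [/\ (0 < i < j)%N, (j <= k)%N & e = ((k, i), (k, j))]) \/
    (exists p q, [/\ (0 < p <= k)%N, (0 < q <= k.+1)%N & e = cross_link k p q])).
Proof.
move=> /flattenP[_ /mapP[k + ->]]; rewrite mem_index_iota => kN.
rewrite mem_cat => /orP[] /flattenP[_ /mapP[i + ->]];
  rewrite mem_index_iota => ik /mapP[j + ->]; rewrite mem_index_iota => ij.
  by exists k; split => //; left; exists i, j; split => //; lia.
by exists k; split => //; right; exists i, j; split => //; lia.
Qed.

Definition ordered N y := forall e, e \in links N -> 0 < gap y e.

(** Only neighbours need to be compared: all the other links follow by going up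
    to the next level. *)
Lemma orderedP N y : ordered N y <->
  (forall k i, (0 < k < N)%N -> (0 < i <= k)%N -> y k.+1 i.+1 < y k i < y k.+1 i).
Proof.
split=> [yo k i kN ik|yo e /linksP[k [kN]]].
  have h1 : cross_link k i i.+1 \in links N by apply: cross_link_in => //; lia.
  have h2 : cross_link k i i \in links N by apply: cross_link_in => //; lia.
  move: (yo _ h1) (yo _ h2); rewrite /cross_link leqnn ltnn /gap /= !subr_gt0.
  by move=> -> ->.
have dec l : (0 < l < N)%N ->
    forall i j, (0 < i)%N -> (i <= j <= l.+1)%N -> y l.+1 j <= y l.+1 i.
  move=> lN i j i0; elim: j => [|j IH]; first by lia.
  move=> /andP[]; rewrite leq_eqVlt => /orP[/eqP->//|ij] jl.
  have /andP[a b] : y l.+1 j.+1 < y l j < y l.+1 j by apply: yo => //; lia.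
  by apply: (le_trans (ltW (lt_trans a b))); apply: IH; lia.
have cr p q : (0 < p <= k)%N -> (0 < q <= k.+1)%N -> 0 < gap y (cross_link k p q).
  move=> pk qk; have /andP[a b] := yo _ _ kN pk.
  rewrite /cross_link; case: leqP => qp; rewrite /gap/= subr_gt0.
    by apply: lt_le_trans b _; apply: dec => //; lia.
  by apply: le_lt_trans a; apply: dec => //; lia.
move=> [[i [j [ij jk ->]]]|[p [q [pk qk ->]]]]; last exact: cr.
have := cr i i.+1; have := cr j j.
rewrite /cross_link leqnn ltnn /gap/= !subr_gt0 => /(_ _ _)/=.
move=> h1 h2; have := h1 _ _; have := h2 _ _.
have /andP[a b] : y k.+1 i.+1 < y k i < y k.+1 i by apply: yo => //; lia.
have /andP[c d] : y k.+1 j.+1 < y k j < y k.+1 j by apply: yo => //; lia.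
move=> _ _; apply: lt_trans a; apply: lt_le_trans d _; apply: dec => //; lia.
Qed.

Definition addscale y s x k i := y k i + s * x k i.

Lemma gap_addscale y s x e : gap (addscale y s x) e = gap y e + s * gap x e.
Proof. by rewrite /gap /addscale; ring. Qed.

Lemma addscale0 y x : addscale y 0 x = y.
Proof.
by apply/funext => k; apply/funext => i; rewrite /addscale mul0r addr0.
Qed.

(** The Hessian of the energy at [y]; see [bform_diag] and [is_derive_slope]. *)
Definition qform N y x : R :=
  - \sum_(e <- links N) charge e * (gap x e / gap y e) ^+ 2.

Lemma qform_scale N y s x :
  qform N y (fun k i => s * x k i) = s ^+ 2 * qform N y x.
Proof.
rewrite /qform mulrN mulr_sumr; congr (- _); apply: eq_bigr => e _.
by rewrite /gap; ring.
Qed.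

Lemma sum_pairs_sym k (f : nat -> nat -> R) : (forall i j, f i j = f j i) ->
  \sum_(1 <= i < k.+1) \sum_(i.+1 <= j < k.+1) f i j =
  2^-1 * \sum_(i < k) \sum_(j < k | j != i) f i.+1 j.+1.
Proof.
move=> fsym; pose g (i j : nat) := if (i < j)%N then f i j else 0.
have -> : \sum_(1 <= i < k.+1) \sum_(i.+1 <= j < k.+1) f i j =
   \sum_(i < k) \sum_(j < k) g i.+1 j.+1.
  rewrite big_add1 big_mkord; apply: eq_bigr => i _.
  rewrite (big_nat_widenl _ 1)//= big_mkcond big_add1 big_mkord.
  by apply: eq_bigr => j _; rewrite /g ltnS.
have -> : \sum_(i < k) \sum_(j < k | j != i) f i.+1 j.+1 =
    \sum_(i < k) \sum_(j < k) g i.+1 j.+1 +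
    \sum_(i < k) \sum_(j < k) g j.+1 i.+1.
  rewrite -big_split; apply: eq_bigr => i _ /=.
  rewrite -big_split big_mkcond; apply: eq_bigr => j _ /=.
  rewrite /g !ltnS -val_eqE /= fsym.
  by case: ltngtP => _; rewrite ?addr0 ?add0r.
by rewrite [X in _ * (_ + X)]exchange_big /=; field.
Qed.

Definition level_form y x k :=
  \sum_(1 <= i < k.+1) \sum_(i.+1 <= j < k.+1) ((x k i - x k j) / (y k i - y k j)) ^+ 2.

Definition cross_form y x k :=
  \sum_(1 <= p < k.+1) \sum_(1 <= q < k.+2)
    ((x k p - x k.+1 q) / (y k p - y k.+1 q)) ^+ 2.

(** The repulsion inside level k is shared equally between the pairs (k - 1, k)
    and (k, k + 1). Nothing is lost at the ends: level 1 has a single point and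
    the direction vanishes on level N. *)
Lemma qform_levels N y x : (forall i, x N i = 0) ->
  qform N y x =
  2^-1 * \sum_(1 <= k < N) (cross_form y x k - level_form y x k - level_form y x k.+1).
Proof.
move=> xN.
have -> : qform N y x = \sum_(1 <= k < N) (2^-1 * cross_form y x k - level_form y x k).
  rewrite /qform (sum_links _ (h := fun e => (gap x e / gap y e) ^+ 2)).
    by rewrite -sumrN; apply: eq_bigr => k _; rewrite opprB.
  move=> e; rewrite /gap/= -[X in X / _]opprB -[X in _ / X]opprB.
  by rewrite invrN mulrNN.
case: N xN => [|[|n]] xN; [by rewrite !big_geq ?mulr0..|].
have sh : \sum_(1 <= k < n.+2) level_form y x k.+1 = \sum_(1 <= k < n.+2) level_form y x k.
  rewrite [LHS]big_nat_recr//= [RHS]big_ltn//= [RHS]addrC; congr (_ + _).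
    by rewrite [RHS]big_add1.
  rewrite /level_form [RHS]big_nat1 [RHS]big_geq//.
  rewrite big1// => i _; rewrite big1// => j _.
  by rewrite !xN subrr mul0r expr0n.
rewrite !sumrB sh -mulr_sumr; by field.
Qed.

(** [cauchy_form_ge] for the levels k and k + 1, with the weights given by
    interpolation. *)
Lemma two_level_form N y k : ordered N y -> (0 < k < N)%N ->
  exists2 kap : 'I_k -> 'I_k.+1 -> R, (forall p q, 0 < kap p q) &
  forall x, \sum_p \sum_q kap p q * (x k p.+1 - x k.+1 q.+1) ^+ 2 <=
     cross_form y x k - level_form y x k - level_form y x k.+1.
Proof.
move=> /orderedP o kN.
pose u i := y k i.+1; pose w i := y k.+1 i.+1.
have uw i : (i < k)%N -> w i.+1 < u i < w i by move=> ik; apply: o.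
have w_inj : injective (fun q : 'I_k.+1 => w q).
  move=> q r qr; apply/val_inj/eqP/negPn/negP => /(interlacing_inj uw).
  by rewrite qr eqxx !leq_ord => /(_ isT isT).
have u_decr (p p' : 'I_k) : (p < p')%N -> u p' < u p.
  move=> pp'; have /andP[a b] := uw _ (ltn_ord p); apply: lt_trans a.
  have /andP[c d] := uw _ (ltn_ord p'); apply: lt_le_trans d _.
  move: pp'; rewrite leq_eqVlt => /orP[/eqP->//|pp'].
  by rewrite ltW// (interlacing_decr uw)// pp' ltnW.
have u_inj : injective (fun p : 'I_k => u p).
  by move=> p p' e; apply/val_inj; case: (ltngtP p p') => // /u_decr;
    rewrite e ltxx.
pose b := @interp_weight R k u w; have b_gt0 : forall q, 0 < b q := interp_weight_gt0 uw.
have uwN (p : 'I_k) (q : 'I_k.+1) : u p != w q.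
  have /andP[l r] := uw _ (ltn_ord p); case: (ltngtP q p) => [qp|qp|->].
  - by rewrite lt_eqF// (lt_trans r)// (interlacing_decr uw)// qp ltnW.
  - move: qp; rewrite leq_eqVlt => /orP[/eqP<-|qp]; first by rewrite gt_eqF.
    by rewrite gt_eqF// (lt_trans _ l)// (interlacing_decr uw)// qp leq_ord.
  - by rewrite lt_eqF.
have key := cauchy_form_ge u_inj w_inj uwN b_gt0 (sum_interp_weight uw)
   (sum_interp_weight_cauchy uw).
exists (fun p q => b q / ((\sum_r b r * (u p - w r)^-1 ^+ 2) * (u p - w q) ^+ 4)).
  move=> p q; rewrite divr_gt0// mulr_gt0//; last first.
    by rewrite exprn_even_gt0//= subr_eq0.
  rewrite (bigD1 ord0)//= ltr_wpDr//.
    by apply: sumr_ge0 => r _; apply: mulr_ge0; [exact: ltW|exact: sqr_ge0].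
  apply: mulr_gt0 => //; rewrite exprn_even_gt0//= invr_eq0 subr_eq0.
  exact: (uwN p ord0).
move=> x'; have h := key (fun p => x' k p.+1) (fun q => x' k.+1 q.+1).
rewrite /level_form !sum_pairs_sym; first last.
- by move=> i j; rewrite -[X in X / _]opprB -[X in _ / X]opprB invrN mulrNN.
- by move=> i j; rewrite -[X in X / _]opprB -[X in _ / X]opprB invrN mulrNN.
rewrite /cross_form big_add1 big_mkord.
by under [X in X - _ - _]eq_bigr do rewrite big_add1 big_mkord.
Qed.

Lemma qform_ge_level N y k : ordered N y -> (0 < k < N)%N ->
  exists2 C, 0 < C & forall x i, (forall i, x N i = 0) -> (0 < i <= k)%N ->
    (x k i - x k.+1 i) ^+ 2 <= C * qform N y x.
Proof.
move=> o kN; have [kap kap0 le_kap] := two_level_form o kN.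
exists (\sum_p \sum_q 2 / kap p q + 1).
  by rewrite ltr_wpDl// sumr_ge0// => p _; rewrite sumr_ge0// => q _;
    rewrite divr_ge0// ltW.
move=> x i xN /andP[i0 ik].
have lev_ge0 l : (0 < l < N)%N ->
    0 <= cross_form y x l - level_form y x l - level_form y x l.+1.
  move=> /(two_level_form o)[kap' kap'0 /(_ x)]; apply: le_trans.
  apply: sumr_ge0 => p _; apply: sumr_ge0 => q _.
  by rewrite mulr_ge0 ?sqr_ge0 ?ltW ?kap'0.
have pk : (i.-1 < k)%N by lia.
pose p := Ordinal pk; pose q := widen_ord (leqnSn k) p.
have iE : i = i.-1.+1 by lia.
have h1 : kap p q * (x k i - x k.+1 i) ^+ 2 <= 2 * qform N y x.
  rewrite qform_levels// mulVKf ?pnatr_eq0//.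
  rewrite (big_rem k) ?mem_index_iota//= -[leLHS]addr0.
  apply: lerD; last first.
    rewrite big_seq; apply: sumr_ge0 => l /mem_rem.
    by rewrite mem_index_iota; exact: lev_ge0.
  apply: le_trans (le_kap x); rewrite (bigD1 p)//= (bigD1 q)//=.
  rewrite -iE -addrA lerDl addr_ge0//.
    by apply: sumr_ge0 => q' _; rewrite mulr_ge0 ?sqr_ge0 ?ltW ?kap0.
  apply: sumr_ge0 => p' _; apply: sumr_ge0 => q' _.
  by rewrite mulr_ge0 ?sqr_ge0 ?ltW ?kap0.
have q0 : 0 <= qform N y x.
  rewrite -(pmulr_rge0 _ (ltr0Sn _ 1)); apply: le_trans h1.
  by rewrite mulr_ge0 ?sqr_ge0 ?ltW ?kap0.
apply: (@le_trans _ _ (2 / kap p q * qform N y x)).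
  by rewrite mulrAC ler_pdivlMr ?kap0// mulrC.
apply: ler_wpM2r => //.
rewrite (bigD1 p)//= (bigD1 q)//= -!addrA lerDl !addr_ge0//.
  by apply: sumr_ge0 => q' _; rewrite divr_ge0 ?ltW ?kap0.
apply: sumr_ge0 => p' _; apply: sumr_ge0 => q' _.
by rewrite divr_ge0 ?ltW ?kap0.
Qed.

Lemma qform_ge0 N y x : ordered N y -> (forall i, x N i = 0) -> 0 <= qform N y x.
Proof.
move=> o xN; rewrite qform_levels// mulr_ge0 ?invr_ge0 ?ler0n//.
rewrite big_seq; apply: sumr_ge0 => l; rewrite mem_index_iota.
move=> /(two_level_form o)[kap' kap'0 /(_ x)]; apply: le_trans.
apply: sumr_ge0 => p _; apply: sumr_ge0 => q _.
by rewrite mulr_ge0 ?sqr_ge0 ?ltW ?kap'0.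
Qed.

(** By induction from the fixed top level downwards: the Hessian form controls the
    difference of entries in consecutive levels. *)
Lemma qform_coercive N y : ordered N y ->
  exists2 C, 0 < C & forall x k i, (forall i, x N i = 0) ->
    (0 < k <= N)%N -> (0 < i <= k)%N -> x k i ^+ 2 <= C * qform N y x.
Proof.
move=> o; (* m is the number of levels below the top that are controlled. *)
suff H m : (m <= N)%N ->
   exists2 C, 0 < C & forall x k i, (forall i, x N i = 0) ->
    (N - m <= k <= N)%N -> (0 < i <= k)%N -> x k i ^+ 2 <= C * qform N y x.
  have [C C0 HC] := H N (leqnn N); exists C => // x k i xN kN; apply: HC => //.
  by rewrite subnn; lia.
elim: m => [|m IH] mN.
  exists 1 => // x k i xN kN _; have -> : k = N by lia.
  by rewrite xN expr0n mul1r qform_ge0.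
have [C C0 HC] := IH (ltnW mN).
have [E|Nm] := eqVneq (N - m.+1)%N 0%N.
  exists C => // x k i xN kN ik; apply: HC => //; lia.
have kN : (0 < N - m.+1 < N)%N by lia.
have [D D0 HD] := qform_ge_level o kN.
exists (2 * C + 2 * D); first by rewrite addr_gt0 ?mulr_gt0.
move=> x k i xN kN' ik; have q0 := qform_ge0 o xN.
have [Ek|Nk] := eqVneq k (N - m.+1)%N; last first.
  apply: (le_trans (HC x k i xN _ ik)); first by lia.
  by apply: ler_wpM2r => //; nra.
have h1 := HD x i xN; rewrite -Ek in h1; move/(_ ik) in h1.
have h2 : x k.+1 i ^+ 2 <= C * qform N y x by apply: HC => //; lia.
by have := sqr_ge0 (x k i - 2 * x k.+1 i); nra.
Qed.

End Links.

(** * The energy near and far from a critical point *)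

Section Energy.
Context {R : realType}.
Implicit Types (y x : nat -> nat -> R) (e : link) (c : nat -> R).


Lemma mvt_closed (f f' : R -> R) (a b : R) : a < b ->
  (forall s, a <= s <= b -> is_derive s 1 f (f' s)) ->
  exists2 s, a < s < b & f b - f a = f' s * (b - a).
Proof.
move=> ab df.
have [s|s|s] := @MVT R f f' a b ab.
- by rewrite in_itv/= => /andP[? ?]; apply: df; rewrite !ltW.
- apply: derivable_within_continuous => r.
  by rewrite in_itv/= => h; have [] := df _ h.
- by rewrite in_itv/= => ? ?; exists s.
Qed.

(** The remainder has derivative s^2/(1 + s), which is at most 2 s^2 on the range
    considered. *)
Lemma ln1D_taylor2 (t : R) : `|t| <= 2^-1 ->
  `|ln (1 + t) - t + t ^+ 2 / 2| <= 2 * `|t| ^+ 3.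
Proof.
rewrite ler_norml => /andP[tl tr].
pose f (s : R) := ln (1 + s) - s + s ^+ 2 / 2.
pose f' (s : R) := s ^+ 2 / (1 + s).
have df (s : R) : - 2^-1 <= s -> is_derive s 1 f (f' s).
  move=> s1; have s1' : 0 < 1 + s by lra.
  have h : is_derive (1 + s) 1 (@ln R) (1 + s)^-1 by exact: is_derive1_ln.
  rewrite /f; apply: is_derive_eq.
  by rewrite /f' /GRing.scale/=; field; rewrite gt_eqF.
have f0 : f 0 = 0 by rewrite /f addr0 ln1 subrr add0r expr0n mul0r.
have bd s : - 2^-1 <= s -> 0 <= f' s <= 2 * s ^+ 2.
  move=> s1; have s1' : 0 < 1 + s by lra.
  rewrite /f' divr_ge0 ?sqr_ge0 ?(ltW s1')//= ler_pdivrMr//.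
  have := sqr_ge0 s; nra.
rewrite -/(f t); have [t0|t0|->] := ltgtP t 0.
- have [s /andP[sl sr]] := mvt_closed t0 (f := f) (f' := f')
    (fun s h => df s (le_trans tl (andP h).1)).
  rewrite f0 !sub0r mulrN => /oppr_inj ->.
  have /andP[h1 h2] := bd s (le_trans tl (ltW sl)).
  rewrite normrM (ger0_norm h1) exprSr mulrA ler_wpM2r//.
  apply: (le_trans h2); rewrite ler_pM2l// -normrX ger0_norm ?sqr_ge0//.
  by rewrite -(sqrrN s) -(sqrrN t) ler_sqr ?nnegrE; lra.
- have [s /andP[sl sr]] := mvt_closed t0 (f := f) (f' := f')
    (fun s h => df s (ltac:(move: h => /andP[]; lra))).
  rewrite f0 !subr0 => ->.
  have /andP[h1 h2] : 0 <= f' s <= 2 * s ^+ 2 by apply: bd; lra.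
  rewrite normrM (ger0_norm h1) exprSr mulrA ler_wpM2r//.
  apply: (le_trans h2); rewrite ler_pM2l// -normrX ger0_norm ?sqr_ge0//.
  by rewrite ler_sqr ?nnegrE; lra.
- by rewrite f0 normr0 expr0n mulr0.
Qed.

Lemma is_derive_sum_seq (V : normedModType R) (I : eqType) (s : seq I)
    (h : I -> V -> R) (dh : I -> R) (a v : V) :
  (forall i, i \in s -> is_derive a v (h i) (dh i)) ->
  is_derive a v (fun u => \sum_(i <- s) h i u) (\sum_(i <- s) dh i).
Proof.
elim: s => [|i s IH] H.
  under eq_fun do rewrite big_nil.
  by rewrite big_nil; exact: is_derive_cst.
under eq_fun do rewrite big_cons.
rewrite big_cons; apply: is_deriveD; first by apply: H; rewrite mem_head.
by apply: IH => j js; apply: H; rewrite in_cons js orbT.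
Qed.

Lemma is_derive_ln_affine (p q t : R) : 0 < p + t * q ->
  is_derive t 1 (fun s => ln (p + s * q)) (q / (p + t * q)).
Proof.
move=> h.
have h1 : is_derive (p + t * q) 1 (@ln R) (p + t * q)^-1 by exact: is_derive1_ln.
by apply: is_derive_eq; rewrite /GRing.scale/=; ring.
Qed.

Lemma is_derive_inv_affine (p q r t : R) : p + t * q != 0 ->
  is_derive t 1 (fun s => r / (p + s * q)) (- (r * q / (p + t * q) ^+ 2)).
Proof.
move=> h; have h1 := @is_deriveV R (fun s => p + s * q) t 1 _ h.
by apply: is_derive_eq; rewrite /GRing.scale/=; field.
Qed.

Section fixed_size.
Variables (N : nat) (c : nat -> R).

Definition drift y : R := \sum_(1 <= k < N) \sum_(1 <= i < k.+1) y k i * c k.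

Lemma drift_addscale y s x : drift (addscale y s x) = drift y + s * drift x.
Proof.
rewrite /drift mulr_sumr -big_split; apply: eq_bigr => k _ /=.
rewrite mulr_sumr -big_split; apply: eq_bigr => i _ /=.
by rewrite /addscale; ring.
Qed.

Definition energy y : R :=
  \sum_(e <- links N) charge e * ln (gap y e) - 2^-1 * drift y.

(** The derivative of the energy at [y] in the direction [x]. *)
Definition slope y x : R :=
  \sum_(e <- links N) charge e * (gap x e / gap y e) - 2^-1 * drift x.

Definition bform y x x' : R :=
  - \sum_(e <- links N) charge e * (gap x e * gap x' e / gap y e ^+ 2).

Lemma bform_diag y x : bform y x x = qform N y x.
Proof.
by rewrite /bform /qform; congr (- _); apply: eq_bigr => e _; rewrite expr_div_n.
Qed.

Lemma is_derive_energy y x t : ordered N (addscale y t x) ->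
  is_derive t 1 (fun s => energy (addscale y s x)) (slope (addscale y t x) x).
Proof.
move=> o; rewrite /energy /slope.
apply: is_deriveB.
  apply: is_derive_sum_seq => e eN; under eq_fun do rewrite gap_addscale.
  rewrite gap_addscale; have := o _ eN; rewrite gap_addscale => h.
  have h1 := is_derive_ln_affine h.
  by apply: is_derive_eq; rewrite /GRing.scale/=; ring.
under eq_fun do rewrite drift_addscale.
by apply: is_derive_eq; rewrite /GRing.scale/=; ring.
Qed.

Lemma is_derive_slope y x x' t : ordered N (addscale y t x) ->
  is_derive t 1 (fun s => slope (addscale y s x) x') (bform (addscale y t x) x' x).
Proof.
move=> o; rewrite /slope.
rewrite -[bform _ _ _]subr0; apply: is_deriveB.
rewrite /bform -sumrN.
apply: is_derive_sum_seq => e eN; under eq_fun do rewrite gap_addscale.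
rewrite gap_addscale; have := o _ eN; rewrite gap_addscale => /lt0r_neq0 h.
have h1 := is_derive_inv_affine (gap x' e) h.
by apply: is_derive_eq; rewrite /GRing.scale/=; ring.
Qed.

Lemma ordered_segment y x t : ordered N y -> ordered N (addscale y 1 x) ->
  0 <= t <= 1 -> ordered N (addscale y t x).
Proof.
move=> oy ox /andP[t0 t1] e eN.
have := oy _ eN; have := ox _ eN; rewrite !gap_addscale mul1r => h1 h2.
have -> : gap y e + t * gap x e = (1 - t) * gap y e + t * (gap y e + gap x e) by ring.
have [->|tn] := eqVneq t 1; first by rewrite subrr mul0r add0r mul1r.
have t1' : t < 1 by rewrite lt_neqAle tn t1.
apply: ltr_wpDr; first by apply: mulr_ge0 => //; exact: ltW.
by apply: mulr_gt0 => //; rewrite subr_gt0.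
Qed.

(** The derivative along the ray vanishes at its origin and is nondecreasing, by
    positivity of the Hessian form all along the ray. *)
Lemma energy_ray_nondecreasing y x t : ordered N y ->
  ordered N (addscale y 1 x) -> (forall i, x N i = 0) -> slope y x = 0 ->
  0 < t <= 1 -> energy (addscale y t x) <= energy (addscale y 1 x).
Proof.
move=> oy ox xN sl /andP[t0 t1].
have oseg s : 0 <= s <= 1 -> ordered N (addscale y s x).
  exact: ordered_segment.
move: t1; rewrite le_eqVlt => /orP[/eqP->//|t1].
rewrite -subr_ge0.
have [s /andP[s0 s1] ->] := mvt_closed t1
  (fun s h => @is_derive_energy y x s (oseg s (ltac:(move: h => /andP[]; lra)))).
apply: mulr_ge0; last by rewrite subr_ge0 ltW.
have s0' : 0 < s by exact: lt_trans s0.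
have [r /andP[r0 r1]] := mvt_closed s0'
  (fun r h => @is_derive_slope y x x r (oseg r (ltac:(move: h => /andP[]; lra)))).
rewrite /= addscale0 sl subr0 => eqs; rewrite {}eqs bform_diag mulr_ge0 ?subr0 ?(ltW s0')//.
by apply: qform_ge0 => //; apply: oseg; lra.
Qed.

(** Makes the relative variation of every gap small as soon as the Hessian form
    is small. *)
Lemma gap_sqr_le y : ordered N y -> exists2 C, 0 < C &
  forall x e, (forall i, x N i = 0) -> e \in links N ->
    (gap x e / gap y e) ^+ 2 <= C * qform N y x.
Proof.
move=> o; have [C C0 HC] := qform_coercive o.
pose S := \sum_(e <- links N) (gap y e ^+ 2)^-1.
have S0 : 0 <= S by apply: sumr_ge0 => e _; rewrite invr_ge0 sqr_ge0.
exists (4 * C * S + 1); first by rewrite ltr_wpDl// !mulr_ge0// ltW.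
move=> x e xN eN; have q0 := qform_ge0 o xN.
have ends k i : (0 < k <= N)%N -> (0 < i <= k)%N -> x k i ^+ 2 <= C * qform N y x.
  by move=> kN ik; exact: HC.
have h : gap x e ^+ 2 <= 4 * C * qform N y x.
  suff [h1 h2] : x e.1.1 e.1.2 ^+ 2 <= C * qform N y x /\
     x e.2.1 e.2.2 ^+ 2 <= C * qform N y x.
    by rewrite /gap; have := sqr_ge0 (x e.1.1 e.1.2 + x e.2.1 e.2.2); nra.
  have [k [kN [[i [j [ij jk ->]]]|[p [q [pk qk ->]]]]]] := linksP eN => /=.
    by split; apply: ends; lia.
  by rewrite /cross_link; case: ifP => _ /=; split; apply: ends; lia.
have g0 := o _ eN.
have hS : (gap y e ^+ 2)^-1 <= S.
  rewrite /S (big_rem e)//= lerDl sumr_ge0// => f _.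
  by rewrite invr_ge0 sqr_ge0.
rewrite expr_div_n; apply: (@le_trans _ _ (4 * C * qform N y x * S)).
  by apply: ler_pM => //; rewrite ?sqr_ge0// invr_ge0 sqr_ge0.
rewrite (_ : (_ + 1) * _ = 4 * C * qform N y x * S + qform N y x) ?lerDl//.
by ring.
Qed.

(** The error is measured by the Hessian form itself, which serves both for the
    limit (eps arbitrary) and for the domination (eps = 1/4). *)
Lemma energy_taylor2 y : ordered N y ->
  (forall x, (forall i, x N i = 0) -> slope y x = 0) ->
  forall eps, 0 < eps -> exists2 rho, 0 < rho &
  forall x, (forall i, x N i = 0) -> qform N y x <= rho ->
    ordered N (addscale y 1 x) /\
    `|energy (addscale y 1 x) - energy y - 2^-1 * qform N y x|
      <= eps * qform N y x.
Proof.
move=> o crit eps eps0; have [C C0 HC] := gap_sqr_le o.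
pose n : R := (size (links N))%:R + 1.
have n0 : 0 < n by rewrite ltr_wpDl.
(* del bounds the relative variation of the gaps; the error of the expansion is
   then at most 2 * del * n * C times the Hessian form. *)
pose del := Num.min 2^-1 (eps / (2 * n * C)).
have del0 : 0 < del by rewrite lt_min invr_gt0 ltr0n /= divr_gt0 ?mulr_gt0.
exists (del ^+ 2 / C); first by rewrite divr_gt0 ?exprn_gt0.
move=> x xN qx; have q0 := qform_ge0 o xN.
pose tau e := gap x e / gap y e.
have tauq e : e \in links N -> tau e ^+ 2 <= C * qform N y x by exact: HC.
have tauE e : e \in links N -> gap x e = gap y e * tau e.
  by move=> /o /lt0r_neq0 h; rewrite /tau; field.
have tau_le e : e \in links N -> `|tau e| <= del.
  move=> eN; rewrite -ler_sqr ?nnegrE// ?(ltW del0)// real_normK ?num_real//.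
  by rewrite (le_trans (tauq _ eN))// mulrC -ler_pdivlMr.
have tau_half e : e \in links N -> `|tau e| <= 2^-1.
  by move=> /tau_le h; rewrite (le_trans h)// ge_min lexx.
have tau_pos e : e \in links N -> 0 < 1 + tau e.
  by move=> /tau_half; rewrite ler_norml => /andP[]; lra.
have gapE e : e \in links N -> gap (addscale y 1 x) e = gap y e * (1 + tau e).
  by move=> eN; rewrite gap_addscale mul1r {1}tauE//; ring.
split=> [e eN|]; first by rewrite gapE// mulr_gt0 ?o ?tau_pos.
have -> : energy (addscale y 1 x) - energy y - 2^-1 * qform N y x =
    \sum_(e <- links N) charge e * (ln (1 + tau e) - tau e + tau e ^+ 2 / 2).
  rewrite -[LHS]subr0 -[X in _ - X](crit x xN) /energy /slope drift_addscale mul1r.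
  rewrite (_ : qform N y x = - \sum_(e <- links N) charge e * tau e ^+ 2)//.
  have -> : \sum_(e <- links N) charge e * ln (gap (addscale y 1 x) e) =
      \sum_(e <- links N) charge e * ln (gap y e) +
      \sum_(e <- links N) charge e * ln (1 + tau e).
    rewrite -big_split/=; apply: eq_big_seq => e eN.
    by rewrite gapE// lnM ?posrE ?o ?tau_pos// mulrDr.
  have -> : \sum_(e <- links N) charge e * (ln (1 + tau e) - tau e + tau e ^+ 2 / 2) =
      \sum_(e <- links N) charge e * ln (1 + tau e)
      - \sum_(e <- links N) charge e * tau e
      + 2^-1 * \sum_(e <- links N) charge e * tau e ^+ 2.
    rewrite mulr_sumr -sumrB -big_split; apply: eq_bigr => e _ /=; ring.
  rewrite -/tau; ring.
apply: (le_trans (ler_norm_sum _ _ _)).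
apply: (@le_trans _ _ (\sum_(e <- links N) 2 * del * (C * qform N y x))).
  rewrite big_seq [leRHS]big_seq; apply: ler_sum => e eN; rewrite normrM.
  apply: (@le_trans _ _ (1 * (2 * `|tau e| ^+ 3))).
    apply: ler_pM => //; last by apply: ln1D_taylor2; exact: tau_half.
    by rewrite /charge; case: ifP => _; rewrite ?normr1// normrN ger0_norm; lra.
  rewrite mul1r -mulrA ler_pM2l// exprS; apply: ler_pM => //.
    exact: tau_le.
  by rewrite real_normK ?num_real//; exact: tauq.
rewrite big_const_seq count_predT iter_addr_0 -[_ *+ size _]mulr_natl.
rewrite !mulrA. apply: ler_wpM2r => //.
have h : del <= eps / (2 * n * C) by rewrite ge_min lexx orbT.
apply: (@le_trans _ _ (n * 2 * del * C)).
  by rewrite !ler_pM2r// lerDl.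
rewrite -ler_pdivlMr// (mulrC _ del) -ler_pdivlMr ?mulr_gt0//.
suff <- : eps / (2 * n * C) = eps / C / (n * 2) by [].
by field; rewrite !gt_eqF.
Qed.

End fixed_size.
End Energy.

(** * The Hamiltonian, its critical points and its Hessian *)

(** The point b + s x. *)
Definition tuple_axpy (R : realType) n (b : n.-tuple R) (s : R) (x : n.-tuple R) :
  n.-tuple R := [tuple tnth b i + s * tnth x i | i < n].

Section Arrays.
Context {R : realType} {N : nat}.
Implicit Types (Y x : 'C(N, 2).-tuple R) (z a : N.-tuple R).

Definition array z Y : nat -> nat -> R := entry (full_array z Y).

(** Variations of the lower levels do not move the top level, so they are completed
    by a top level of zeros. *)
Definition direction Y : nat -> nat -> R := array [tuple of nseq N 0] Y.

Lemma arrayE z Y k i : array z Y k i =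
  if ('C(k, 2) + i.-1 < 'C(N, 2))%N then nth 0 Y ('C(k, 2) + i.-1)
  else nth 0 z ('C(k, 2) + i.-1 - 'C(N, 2)).
Proof. by rewrite /array /entry /full_array /= nth_cat size_tuple. Qed.

Lemma directionE Y k i : direction Y k i =
  if ('C(k, 2) + i.-1 < 'C(N, 2))%N then nth 0 Y ('C(k, 2) + i.-1) else 0.
Proof. by rewrite /direction arrayE; case: ifP => // _; rewrite nth_nseq if_same. Qed.

Lemma direction_top Y i : direction Y N i = 0.
Proof. by rewrite directionE ltnNge leq_addr. Qed.

Lemma array_axpy z Y s x :
  array z (tuple_axpy Y s x) = addscale (array z Y) s (direction x).
Proof.
apply/funext => k; apply/funext => i.
rewrite /addscale !arrayE directionE.
case: ltnP => h; last by rewrite mulr0 addr0.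
have e (t : 'C(N, 2).-tuple R) : nth 0 t ('C(k, 2) + i.-1) = tnth t (Ordinal h).
  by rewrite (tnth_nth 0).
by rewrite !e tnth_mktuple.
Qed.

Lemma direction_sum x k i : direction x k i =
  \sum_p tnth x p * direction (tuple_of_row (delta_mx ord0 p)) k i.
Proof.
under eq_bigr do rewrite directionE.
rewrite directionE; case: ltnP => h; last by rewrite big1// => p _; rewrite mulr0.
have e (t : 'C(N, 2).-tuple R) : nth 0 t ('C(k, 2) + i.-1) = tnth t (Ordinal h).
  by rewrite (tnth_nth 0).
under eq_bigr do rewrite e tnth_mktuple mxE eqxx /=.
rewrite e (bigD1 (Ordinal h))//= eqxx mulr1 big1 ?addr0// => p ph.
by rewrite eq_sym (negbTE ph) mulr0.
Qed.

Lemma gap_direction_sum x e : gap (direction x) e =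
  \sum_p tnth x p * gap (direction (tuple_of_row (delta_mx ord0 p))) e.
Proof.
rewrite /gap 2!direction_sum -sumrB; apply: eq_bigr => p _.
by rewrite mulrBr.
Qed.

Lemma strictly_interlacing_ordered z Y :
  strictly_interlacing_array z Y <-> ordered N (array z Y).
Proof.
rewrite orderedP; split=> [[wk ne] k i kN ik|o].
  have /andP[l r] := wk k kN i ik.
  rewrite !lt_neqAle l r !andbT; apply/andP; split; last by apply: ne => //; lia.
  by rewrite eq_sym; apply: ne => //; lia.
rewrite /strictly_interlacing_array/= /interlacing_array/= -/(array z Y).
split=> [k kN i ik|k i j kN ik jk].
  by have /andP[l r] := o k i kN ik; rewrite !ltW.
have /orderedP o' := o.
have := o' _ (cross_link_in kN ik jk); rewrite /cross_link /gap.
by case: ifP => _ /=; rewrite subr_gt0 => h; rewrite ?(lt_eqF h) ?(gt_eqF h).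
Qed.

Lemma hamiltonianE a z Y : ordered N (array z Y) ->
  hamiltonian a z Y = energy N (increment a) (array z Y).
Proof.
move=> o; rewrite /hamiltonian /energy -/(array z Y).
have -> : \sum_(e <- links N) charge e * ln (gap (array z Y) e) =
   \sum_(e <- links N) charge e * ln `|gap (array z Y) e|.
  by apply: eq_big_seq => e eN; rewrite gtr0_norm ?o.
rewrite (sum_links _ (h := fun e => ln `|gap (array z Y) e|)); last first.
  by move=> e; rewrite /gap distrC.
rewrite /drift mulr_sumr -sumrB; apply: eq_big_nat => k kN.
congr (_ - _ - _).
  apply: eq_big_nat => i ik; apply: eq_big_nat => j ij.
  rewrite /gap/= gtr0_norm//.
  by have /o : ((k, i), (k, j)) \in links N by apply: level_link_in => //; lia.
by rewrite !mulr_sumr; apply: eq_bigr => i _; field.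
Qed.

(** The derivative of the repulsion inside a level, grouped by particles instead
    of by pairs. *)
Lemma sum_pairs_antisym (y x : nat -> R) k :
  \sum_(1 <= i < k.+1) \sum_(i.+1 <= j < k.+1) (x i - x j) / (y i - y j) =
  \sum_(1 <= i < k.+1) x i * \sum_(1 <= j < k.+1 | j != i) (y i - y j)^-1.
Proof.
rewrite (sum_pairs_sym _ (f := fun i j => (x i - x j) / (y i - y j))); last first.
  by move=> i j; rewrite -[x i - x j]opprB -[y i - y j]opprB invrN mulrNN.
pose F := \sum_(i < k) \sum_(j < k | j != i) x i.+1 / (y i.+1 - y j.+1).
have -> : \sum_(1 <= i < k.+1) x i * \sum_(1 <= j < k.+1 | j != i) (y i - y j)^-1 = F.
  rewrite big_add1 big_mkord; apply: eq_bigr => i _.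
  by rewrite big_add1 big_mkord /= mulr_sumr; apply: eq_bigl.
have -> : \sum_(i < k) \sum_(j < k | j != i) (x i.+1 - x j.+1) / (y i.+1 - y j.+1) =
   F + F; last by field.
have F2 : F = \sum_(i < k) \sum_(j < k | j != i) x j.+1 / (y j.+1 - y i.+1).
  rewrite /F (exchange_big_dep xpredT)//=; apply: eq_bigr => i _.
  by apply: eq_bigl => j; rewrite eq_sym.
rewrite {2}F2 -big_split; apply: eq_bigr => i _ /=.
rewrite -big_split; apply: eq_bigr => j _ /=.
by rewrite -[y j.+1 - y i.+1]opprB invrN; ring.
Qed.

(** The derivative is the sum over the particles of x k i times the equation of
    the lattice at (k, i). The terms of a link between the levels k and k + 1 that
    belong to its upper end are moved to level k + 1, where the equation expects
    them. *)
Lemma lattice_slope0 a z Y : deformed_lattice a z Y ->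
  forall x : nat -> nat -> R, (forall i, x N i = 0) ->
  slope N (increment a) (array z Y) x = 0.
Proof.
move=> [_ eqs] x xN; rewrite /slope; set y := array z Y.
rewrite (sum_links _ (h := fun e => gap x e / gap y e)); last first.
  by move=> e; rewrite /gap/= -[X in X / _]opprB -[X in _ / X]opprB invrN mulrNN.
pose S k := \sum_(1 <= i < k.+1) x k i * \sum_(1 <= j < k.+1 | j != i) (y k i - y k j)^-1.
pose U k := \sum_(1 <= i < k.+1) x k i * \sum_(1 <= q < k.+2) (y k i - y k.+1 q)^-1.
pose D k := \sum_(1 <= i < k.+1) x k i * \sum_(1 <= p < k) (y k i - y k.-1 p)^-1.
have -> : 2^-1 * drift N (increment a) x =
    \sum_(1 <= k < N) (S k - 2^-1 * U k - 2^-1 * D k).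
  rewrite /drift mulr_sumr; apply: eq_big_nat => k kN.
  rewrite /S /U /D !mulr_sumr -!sumrB; apply: eq_big_nat => i ik.
  have := eqs k i kN ik; rewrite -/(array z Y) -/y => e.
  transitivity (x k i * (increment a k / 2)); first by field.
  by rewrite -e; ring.
have shift : \sum_(1 <= k < N) D k.+1 = \sum_(1 <= k < N) D k.
  case: N xN => [|[|n]] xN; [by rewrite !big_geq..|].
  rewrite [LHS]big_nat_recr//= [RHS]big_ltn//= [RHS]addrC; congr (_ + _).
    by rewrite [RHS]big_add1.
  rewrite /D [RHS]big_nat1 [X in _ = _ * X]big_geq// mulr0.
  by rewrite big1// => i _; rewrite xN mul0r.
rewrite !sumrB -!mulr_sumr -shift.
transitivity (\sum_(1 <= k < N) (0 : R)); last by rewrite big1.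
rewrite !mulr_sumr -!sumrB; apply: eq_big_nat => k kN.
rewrite /gap/= sum_pairs_antisym -/(S k).
have -> : \sum_(1 <= p < k.+1) \sum_(1 <= q < k.+2)
    (x k p - x k.+1 q) / (y k p - y k.+1 q) = U k + D k.+1.
  rewrite /U /D /= [X in _ + X](_ : _ = \sum_(1 <= p < k.+1) \sum_(1 <= q < k.+2)
    x k.+1 q / (y k.+1 q - y k p)); last first.
    by rewrite exchange_big; apply: eq_bigr => q _; rewrite mulr_sumr.
  rewrite -big_split; apply: eq_bigr => p _ /=.
  rewrite mulr_sumr -big_split; apply: eq_bigr => q _ /=.
  by rewrite -[y k.+1 q - y k p]opprB invrN; ring.
by ring.
Qed.

Lemma tuple_of_row_axpy n (r v : 'rV[R]_n) (t : R) :
  tuple_of_row (t *: v + r) = tuple_axpy (tuple_of_row r) t (tuple_of_row v).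
Proof.
by apply: eq_from_tnth => i; rewrite !tnth_mktuple !mxE addrC.
Qed.

(** Reduces directional derivatives to the one-variable derivatives computed for
    arrays. *)
Lemma is_derive_line (V : normedModType R) (F : V -> R) (r v : V) (l : R) :
  is_derive (0 : R) 1 (fun t : R => F (t *: v + r)) l -> is_derive r v F l.
Proof.
pose G t := F (t *: v + r).
have e : (fun h : R => h^-1 *: ((G \o shift 0) (h *: 1) - G 0)) =
         (fun h : R => h^-1 *: ((F \o shift r) (h *: v) - F r)).
  apply/funext => h; rewrite /G /= addr0 scale0r add0r.
  by rewrite /GRing.scale /= mulr1.
case=> dG vG; split.
  by move: dG; rewrite /derivable -/G e.
by move: vG; rewrite /derive -/G e.
Qed.

(** Strict interlacing is an open condition, hence the formula for the first
    derivatives holds in a neighbourhood and can be differentiated again. *)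
Lemma near_ordered z (r : 'rV[R]_('C(N, 2))) :
  ordered N (array z (tuple_of_row r)) ->
  \forall s \near r, ordered N (array z (tuple_of_row s)).
Proof.
move=> o.
have ct k i : continuous (fun s : 'rV[R]_('C(N, 2)) => array z (tuple_of_row s) k i).
  have [h|h] := ltnP ('C(k, 2) + i.-1) 'C(N, 2).
    have -> : (fun s : 'rV[R]_('C(N, 2)) => array z (tuple_of_row s) k i) =
        (fun s : 'rV[R]_('C(N, 2)) => s ord0 (Ordinal h)).
      apply/funext => s; rewrite arrayE h.
      have -> : nth 0 (tuple_of_row s) ('C(k, 2) + i.-1) = tnth (tuple_of_row s) (Ordinal h).
        by rewrite (tnth_nth 0).
      by rewrite tnth_mktuple.
    exact: coord_continuous.
  have -> : (fun s : 'rV[R]_('C(N, 2)) => array z (tuple_of_row s) k i) =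
      (fun=> nth 0 z ('C(k, 2) + i.-1 - 'C(N, 2))).
    by apply/funext => s; rewrite arrayE ltnNge h.
  exact: cst_continuous.
have cg e : continuous (fun s : 'rV[R]_('C(N, 2)) => gap (array z (tuple_of_row s)) e).
  move=> s; have h1 := ct e.1.1 e.1.2 s; have h2 := ct e.2.1 e.2.2 s.
  exact: (cvgB h1 h2).
suff H (s : seq link) : {subset s <= links N} ->
    \forall t \near r, forall e, e \in s -> 0 < gap (array z (tuple_of_row t)) e.
  exact: H.
elim: s => [|e s IH] sN; first by near=> t.
have h1 : \forall t \near r, 0 < gap (array z (tuple_of_row t)) e.
  have eN : e \in links N by apply: sN; exact: mem_head.
  exact: (cvgr_gt _ (cg e r) _ (o _ eN)).
have h2 : \forall t \near r, forall e, e \in s ->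
    0 < gap (array z (tuple_of_row t)) e.
  by apply: IH => f fs; apply: sN; rewrite in_cons fs orbT.
apply: filterS2 h1 h2 => t he hs f.
by rewrite in_cons => /orP[/eqP->|/hs].
Unshelve. all: by end_near. Qed.

Lemma is_derive_hamiltonian a z (r v : 'rV[R]_('C(N, 2))) :
  ordered N (array z (tuple_of_row r)) ->
  is_derive r v (hamiltonian a z \o @tuple_of_row R _)
    (slope N (increment a) (array z (tuple_of_row r)) (direction (tuple_of_row v))).
Proof.
move=> o; apply: (@near_eq_is_derive _ _ _
    (fun s => energy N (increment a) (array z (tuple_of_row s)))).
  have := near_ordered o; apply: filterS => s os.
  by rewrite /= hamiltonianE.
apply: is_derive_line; under eq_fun do rewrite tuple_of_row_axpy array_axpy.
have := @is_derive_energy R N (increment a) (array z (tuple_of_row r)) (direction (tuple_of_row v)) 0.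
by rewrite addscale0; apply.
Qed.

Lemma hessian_hamiltonian a z Y p q : ordered N (array z Y) ->
  hessian (hamiltonian a z) Y p q =
  bform N (array z Y) (direction (tuple_of_row (delta_mx ord0 q)))
     (direction (tuple_of_row (delta_mx ord0 p))).
Proof.
move=> o; rewrite mxE; set r := row_of_tuple Y.
have rY : tuple_of_row r = Y.
  by apply: eq_from_tnth => i; rewrite tnth_mktuple mxE.
have o' : ordered N (array z (tuple_of_row r)) by rewrite rY.
rewrite (@near_eq_derive _ _ _ _ (fun s => slope N (increment a)
   (array z (tuple_of_row s)) (direction (tuple_of_row (delta_mx ord0 q))))).
  have [] // : is_derive r (delta_mx ord0 p) (fun s => slope N (increment a)
   (array z (tuple_of_row s)) (direction (tuple_of_row (delta_mx ord0 q))))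
   (bform N (array z Y) (direction (tuple_of_row (delta_mx ord0 q)))
     (direction (tuple_of_row (delta_mx ord0 p)))).
  apply: is_derive_line; under eq_fun do rewrite tuple_of_row_axpy array_axpy rY.
  have := @is_derive_slope R N (increment a) (array z Y) (direction (tuple_of_row (delta_mx ord0 p)))
     (direction (tuple_of_row (delta_mx ord0 q))) 0.
  by rewrite addscale0; apply.
have := near_ordered o'; apply: filterS => s os.
by have [] := is_derive_hamiltonian a (delta_mx ord0 q) os.
Qed.

Lemma gaussian_weightE a z Y x : ordered N (array z Y) ->
  gaussian_weight (hessian (hamiltonian a z) Y) x =
  expR (- (2^-1 * qform N (array z Y) (direction x))).
Proof.
move=> o; rewrite /gaussian_weight; congr (expR (- (_ * _))).
under eq_bigr do under eq_bigr do rewrite hessian_hamiltonian//.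
rewrite -bform_diag /bform.
transitivity (- \sum_p \sum_q \sum_(e <- links N) charge e *
   (tnth x p * gap (direction (tuple_of_row (delta_mx ord0 p))) e) *
   (tnth x q * gap (direction (tuple_of_row (delta_mx ord0 q))) e) /
    gap (array z Y) e ^+ 2).
  rewrite -sumrN; apply: eq_bigr => p _; rewrite -sumrN; apply: eq_bigr => q _.
  rewrite mulrN mulNr mulr_sumr mulr_suml; congr (- _).
  by apply: eq_bigr => e _; ring.
congr (- _); under eq_bigr do rewrite exchange_big.
rewrite exchange_big; apply: eq_bigr => e _ /=.
rewrite gap_direction_sum big_distrlr/= mulr_suml mulr_sumr.
apply: eq_bigr => p _; rewrite mulr_suml mulr_sumr; apply: eq_bigr => q _.
by rewrite !mulrA.
Qed.

End Arrays.

(** * Lebesgue measure on tuples and integration against a density *)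

Section Scaling.
Context {R : realType}.

Let affine (b s : R) (x : measurableTypeR R) : measurableTypeR R := b + s * x.

Let measurable_affine b s : measurable_fun setT (affine b s).
Proof.
by apply: measurable_funD; [exact: measurable_cst|exact: measurable_funM].
Qed.

(** By uniqueness of Lebesgue measure: its image under the affine map, multiplied
    by s, gives intervals their length. *)
Lemma ge0_integral_affine (b s : R) (f : measurableTypeR R -> \bar R) : 0 < s ->
  measurable_fun setT f -> (forall x, 0 <= f x)%E ->
  (\int[lebesgue_measure]_x f (b + s * x)%R =
   s^-1%:E * \int[lebesgue_measure]_x f x)%E.
Proof.
move=> s0 mf f0.
have sge0 : 0 <= s by exact: ltW.
pose push : {measure set (measurableTypeR R) -> \bar R} :=
  pushforward (@lebesgue_measure R) (affine b s).
pose mu : {measure set (measurableTypeR R) -> \bar R} :=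
  mscale (NngNum sge0) (push (@measurable_affine b s)).
have muE A : measurable A -> lebesgue_measure A = mu A.
  apply: lebesgue_measure_unique => _ [[c d] _ <-].
  rewrite [RHS](_ : _ = s%:E * lebesgue_measure (affine b s @^-1` `]c, d]%classic))%E//.
  have -> : affine b s @^-1` `]c, d]%classic = `](c - b) / s, (d - b) / s]%classic.
    apply/seteqP; split => x; rewrite /= !in_itv/= /affine.
      by move=> /andP[h1 h2]; rewrite ltr_pdivrMr// ler_pdivlMr//; lra.
    by rewrite ltr_pdivrMr// ler_pdivlMr// => /andP[h1 h2]; lra.
  rewrite !lebesgue_measure_itv/= !lte_fin ltr_pM2r ?invr_gt0// ltrD2r.
  case: ifPn => _; last by rewrite mule0.
  by rewrite -!EFinB -EFinM; congr (_%:E); field; rewrite gt_eqF.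
have -> : (\int[lebesgue_measure]_x f x = \int[mu]_x f x)%E.
  by apply: eq_measure_integral => A mA _; exact: muE.
rewrite ge0_integral_mscale//= (ge0_integral_pushforward (measurable_affine b s))//.
by rewrite muleA -EFinM mulVf ?gt_eqF// mul1e preimage_setT.
Qed.

Lemma measurable_cons_pair n : measurable_fun setT (@cons_pair R n).
Proof. exact: measurable_cons. Qed.

Lemma ge0_integral_lebesgue_cons n (f : n.+1.-tuple R -> \bar R) :
  measurable_fun setT f -> (forall x, 0 <= f x)%E ->
  (\int[lebesgue_tuple R n.+1]_x f x =
   \int[lebesgue_measure]_x \int[lebesgue_tuple R n]_t f (cons_pair (x, t)))%E.
Proof.
move=> mf f0.
have -> : (\int[lebesgue_tuple R n.+1]_x f x =
    \int[pushforward (lebesgue_measure \x (lebesgue_tuple R n)) (@cons_pair R n)]_x f x)%E by [].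
rewrite (ge0_integral_pushforward (@measurable_cons_pair n))//.
rewrite preimage_setT fubini_tonelli1//.
  exact: measurableT_comp (@measurable_cons_pair n).
by move=> x; exact: f0.
Qed.

Lemma measurable_tuple_axpy n (b : n.-tuple R) s :
  measurable_fun setT (tuple_axpy b s).
Proof.
apply/measurable_fun_tnthP => i.
rewrite (_ : _ \o _ = fun x => tnth b i + s * tnth x i); last first.
  by apply/funext => x /=; rewrite tnth_mktuple.
apply: measurable_funD; first exact: measurable_cst.
by apply: measurable_funM; [exact: measurable_cst|exact: measurable_tnth].
Qed.

(** One coordinate at a time, by the theorem of Fubini and Tonelli. *)
Lemma ge0_integral_tuple_axpy n (b : n.-tuple R) s (f : n.-tuple R -> \bar R) :
  0 < s -> measurable_fun setT f -> (forall x, 0 <= f x)%E ->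
  (\int[lebesgue_tuple R n]_x f (tuple_axpy b s x) =
   (s^-1 ^+ n)%:E * \int[lebesgue_tuple R n]_x f x)%E.
Proof.
move=> s0; elim: n b f => [|n IH] b f mf f0.
  rewrite expr0 mul1e; apply: eq_integral => x _.
  by rewrite (tuple0 x) (tuple0 (tuple_axpy _ _ _)).
rewrite !ge0_integral_lebesgue_cons//; last first.
  exact: measurableT_comp (measurable_tuple_axpy _ _).
have [b0 [b' bE]] : exists b0 b', b = cons_pair (b0, b').
  by exists (thead b), [tuple of behead b]; rewrite /cons_pair/= [LHS]tuple_eta.
have axE x t : tuple_axpy b s (cons_pair (x, t)) =
    cons_pair (b0 + s * x, tuple_axpy b' s t).
  apply: eq_from_tnth => i; rewrite tnth_mktuple bE.
  by case: (unliftP ord0 i) => [j|] ->; rewrite ?tnth0// !tnthS tnth_mktuple.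
have mfx x : measurable_fun setT (fun t : n.-tuple R => f (cons_pair (x, t))).
  apply: (measurableT_comp mf); apply: measurableT_comp.
    exact: measurable_cons_pair.
  exact: measurable_pair1.
transitivity (\int[lebesgue_measure]_x ((s^-1 ^+ n)%:E *
   \int[lebesgue_tuple R n]_t f (cons_pair ((b0 + s * x)%R, t))))%E.
  apply: eq_integral => x _; under eq_integral do rewrite axE.
  exact: (IH b' (fun t => f (cons_pair (b0 + s * x, t)))).
have mF : measurable_fun setT (fun x : measurableTypeR R =>
    \int[lebesgue_tuple R n]_t f (cons_pair (x, t)))%E.
  apply: (@measurable_fun_fubini_tonelli_F _ _ _ _ _ (lebesgue_tuple R n)
     (f \o @cons_pair R n)) => //.
    exact: measurableT_comp (@measurable_cons_pair n).
  by move=> x; exact: f0.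
have F0 x : (0 <= \int[lebesgue_tuple R n]_t f (cons_pair (x, t)))%E.
  exact: integral_ge0.
rewrite ge0_integralZl//; first last.
- by rewrite lee_fin exprn_ge0// invr_ge0 ltW.
- exact: (measurableT_comp mF (measurable_affine b0 s)).
rewrite (ge0_integral_affine _ s0 mF F0).
by rewrite muleA -EFinM -exprSr.
Qed.

End Scaling.

Section Density.
Context d (T : measurableType d) {R : realType} (P : probability T R).
Context n (X : {RV P >-> n.-tuple R}) (f : n.-tuple R -> R).

(** The density is almost everywhere a Radon-Nikodym derivative, for which the
    change of measure is known. *)
Lemma ge0_expectation_density (c : R) (G : n.-tuple R -> R) :
  0 <= c -> (forall x, 0 <= f x) -> measurable_fun setT f ->
  (forall A, measurable A ->
    distribution P X A = (\int[lebesgue_tuple R n]_(x in A) (c * f x)%:E)%E) ->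
  (forall x, 0 <= G x) -> measurable_fun setT G ->
  (\int[P]_w (G (X w))%:E =
   c%:E * \int[lebesgue_tuple R n]_x (G x * f x)%:E)%E.
Proof.
move=> c0 f0 mf hf G0 mG; pose mu := lebesgue_tuple R n.
have mcf : measurable_fun setT (fun x => (c * f x)%:E).
  by apply/measurable_EFinP; apply: measurable_funM.
have cf0 x : (0 <= (c * f x)%:E)%E by rewrite lee_fin mulr_ge0.
pose nu : {finite_measure set (n.-tuple R) -> \bar R} := distribution P X.
have dom : nu `<< mu.
  apply/null_content_dominatesP => A mA muA0.
  by rewrite /nu/= hf// null_set_integral//; exact: measurable_funTS.
have intcf : mu.-integrable setT (fun x => (c * f x)%:E).
  apply/integrableP; split => //.
  under eq_integral do rewrite gee0_abs//.
  by rewrite -hf// probability_setT ltry.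
have ae : ae_eq mu setT (fun x => (c * f x)%:E) (Radon_Nikodym_SigmaFinite.f nu mu).
  apply: integral_ae_eq => //.
    exact: measurable_int (Radon_Nikodym_SigmaFinite.f_integrable dom).
  move=> A _ mA; rewrite -Radon_Nikodym_SigmaFinite.f_integral//.
  by rewrite /nu/= hf.
have mGE : measurable_fun setT (EFin \o G) by exact/measurable_EFinP.
have GE0 x : (0 <= (EFin \o G) x)%E by rewrite /= lee_fin.
rewrite -(ge0_integral_distribution X mGE GE0).
rewrite -[LHS](Radon_Nikodym_SigmaFinite.change_of_variables dom GE0 measurableT mGE).
have mGf : measurable_fun setT (fun x => (G x * f x)%:E).
  by apply/measurable_EFinP; apply: measurable_funM.
have Gf0 x : setT x -> (0 <= (G x * f x)%:E)%E by rewrite lee_fin mulr_ge0.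
rewrite -ge0_integralZl//.
apply: ae_eq_integral => //.
- apply: emeasurable_funM => //.
  exact: measurable_int (Radon_Nikodym_SigmaFinite.f_integrable dom).
- apply/measurable_EFinP; apply: measurable_funM => //.
  exact: measurable_funM.
apply: filterS ae => x /(_ I) <- _ /=.
by rewrite -!EFinM; congr (_%:E); ring.
Qed.

End Density.

(** * Measurability *)

Section MeasurableRow.
Context {R : realType}.

(** An open set of row vectors is the union of the boxes with rational centre and
    radius 1/(k + 1) that it contains, and there are countably many of them. *)
Lemma measurable_open_row n (U : set 'rV[R]_n) : open U ->
  measurable [set t : n.-tuple R | U (row_of_tuple t)].
Proof.
move=> oU.
pose box (p : n.-tuple rat * nat) : set (n.-tuple R) :=
  [set t | forall i, `|tnth t i - ratr (tnth p.1 i)| < p.2.+1%:R^-1].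
pose good (p : n.-tuple rat * nat) := box p `<=` [set t | U (row_of_tuple t)].
have mbox p : measurable (box p).
  rewrite (_ : box p = \bigcap_(i in [set: 'I_n])
      [set t : n.-tuple R | `|tnth t i - ratr (tnth p.1 i)| < p.2.+1%:R^-1]).
    apply: fin_bigcap_measurable => // i _.
    rewrite -[X in measurable X]setTI.
    have m : measurable_fun setT (fun t : n.-tuple R => `|tnth t i - ratr (tnth p.1 i)|).
      apply: measurableT_comp => //; apply: measurable_funB; last exact: measurable_cst.
      exact: measurable_tnth.
    have := m measurableT `]-oo, p.2.+1%:R^-1[%classic (measurable_itv _).
    by congr (measurable (_ `&` _)); apply/seteqP; split => t /=; rewrite in_itv.
  by apply/seteqP; split => t h i; [move=> _; exact: h|exact: (h i I)].
rewrite (_ : [set t | _] = \bigcup_p (if `[<good p>] then box p else set0)).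
  apply: countable_bigcupT_measurable => [|p]; first exact: countableP.
  by case: ifP => _; [exact: mbox|exact: measurable0].
apply/seteqP; split => [t /= Ut|t [p _]]; last first.
  by case: ifP => [/asboolP gp|//] /gp.
have /nbhs_ballP[e e0 be] : nbhs (row_of_tuple t) U.
  by apply: open_nbhs_nbhs; split.
have [k ke] : exists k : nat, k.+1%:R^-1 < e / 2.
  pose k := Num.truncn (2 / e).
  exists k; rewrite invf_plt ?posrE ?divr_gt0// invf_div.
  exact: truncnS_gt.
have k0 : 0 < k.+1%:R^-1 :> R by rewrite invr_gt0.
have /fin_all_exists[q hq] i : exists q : rat, `|tnth t i - ratr q| < k.+1%:R^-1.
  have [q] : exists q : rat, ratr q \in `]tnth t i - k.+1%:R^-1, tnth t i + k.+1%:R^-1[.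
    by apply: rat_in_itvoo; rewrite ltrD2l gtrN.
  rewrite in_itv/= => /andP[h1 h2]; exists q; rewrite ltr_distlC.
  by rewrite h1 h2.
exists ([tuple q i | i < n], k) => //.
have g : good ([tuple q i | i < n], k).
  move=> s hs; apply: be; split => // i j; rewrite /ball/= !mxE.
  have h1 := hs j; rewrite /= tnth_mktuple in h1.
  apply: le_lt_trans (ler_distD (ratr (q j)) _ _) _.
  rewrite (distrC (ratr _)); apply: lt_trans (ltrD (hq j) h1) _.
  by rewrite [ltRHS]splitr; exact: ltrD.
by rewrite asboolT// => i /=; rewrite tnth_mktuple.
Qed.

Lemma measurable_continuous_row n (g : 'rV[R]_n -> R) : continuous g ->
  measurable_fun setT (fun t : n.-tuple R => g (row_of_tuple t)).
Proof.
move=> cg; apply: (measurability _ (RGenOInfty.measurableE R)) => //.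
move=> _ [_ [a ->] <-]; rewrite setTI.
have := @measurable_open_row n (g @^-1` `]a, +oo[%classic); apply.
by move/continuousP : cg; apply; exact: interval_open.
Qed.

Lemma measurable_full_array N (z : N.-tuple R) :
  measurable_fun setT (full_array z).
Proof.
apply/measurable_fun_tnthP => i.
have [h|h] := ltnP i 'C(N, 2).
  rewrite (_ : _ \o _ = fun Y => tnth Y (Ordinal h)); first exact: measurable_tnth.
  apply/funext => Y; rewrite /= !(tnth_nth 0) /full_array/= nth_cat size_tuple.
  by rewrite h.
rewrite (_ : _ \o _ = cst (nth 0 z (i - 'C(N, 2)))); first exact: measurable_cst.
apply/funext => Y; rewrite /= !(tnth_nth 0) /full_array/= nth_cat size_tuple.
by rewrite ltnNge h.
Qed.

Lemma measurable_array N (z : N.-tuple R) k i :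
  measurable_fun setT (fun Y => array z Y k i).
Proof.
have [h|h] := ltnP ('C(k, 2) + i.-1) 'C(N, 2).
  rewrite (_ : (fun Y => _) = fun Y => tnth Y (Ordinal h)).
    exact: measurable_tnth.
  by apply/funext => Y; rewrite arrayE h (tnth_nth 0).
rewrite (_ : (fun Y => _) = cst (nth 0 z ('C(k, 2) + i.-1 - 'C(N, 2)))).
  exact: measurable_cst.
by apply/funext => Y; rewrite arrayE ltnNge h.
Qed.

Lemma measurable_gap N (z : N.-tuple R) e :
  measurable_fun setT (fun Y => gap (array z Y) e).
Proof. by apply: measurable_funB; exact: measurable_array. Qed.

Lemma measurable_ordered N (z : N.-tuple R) :
  measurable [set Y | ordered N (array z Y)].
Proof.
rewrite (_ : [set _ | _] = \big[setI/setT]_(e <- links N)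
    [set Y | 0 < gap (array z Y) e]).
  apply: big_ind => // [|e _]; first exact: measurableI.
  rewrite -[X in measurable X]setTI.
  have m : measurable_fun setT (fun Y => gap (array z Y) e) by exact: measurable_gap.
  have := m measurableT (`]0, +oo[%classic : set R) (measurable_itv _).
  by congr (measurable (_ `&` _)); apply/seteqP; split => t /=; rewrite in_itv/= andbT.
rewrite -bigcap_seq.
by apply/seteqP; split => Y /= h e eN; exact: h.
Qed.

Lemma measurable_drift N c (z : N.-tuple R) :
  measurable_fun setT (fun Y => drift N c (array z Y)).
Proof.
apply: measurable_sum => k; apply: measurable_sum => i.
by apply: measurable_funM; [exact: measurable_array|exact: measurable_cst].
Qed.

Lemma measurable_energy N c (z : N.-tuple R) :
  measurable_fun setT (fun Y => energy N c (array z Y)).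
Proof.
apply: measurable_funB.
  apply: measurable_sum => e; apply: measurable_funM; first exact: measurable_cst.
  by apply: measurableT_comp; [exact: measurable_ln|exact: measurable_gap].
by apply: measurable_funM; [exact: measurable_cst|exact: measurable_drift].
Qed.

Lemma measurable_qform N y (z : N.-tuple R) :
  measurable_fun setT (fun x => qform N y (array z x)).
Proof.
apply: measurableT_comp => //.
apply: measurable_sum => e; apply: measurable_funM; first exact: measurable_cst.
apply: measurable_funX; apply: measurable_funM; first exact: measurable_gap.
exact: measurable_cst.
Qed.
End MeasurableRow.

(** * Laplace's method *)

(** The excess energy [E] has its minimum 0 at [b] and Hessian form [Q] there; it
    is defined on the domain [D]. All the hypotheses are stated on rays b + t x,
    since t is 1/sqrt beta and x the blown-up variable in the application.
    The hypothesis [far] is what convexity of E gives. *)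
Section Laplace.
Context {R : realType} {n : nat}.
Local Notation V := (n.-tuple R).
Local Notation mu := (lebesgue_tuple R n).
Variables (b : V) (D : set V) (E L L0 Q : V -> R) (K : R).
Hypothesis mD : measurable D.
Hypothesis mE : measurable_fun setT E.
Hypothesis mL : measurable_fun setT L.
Hypothesis mQ : measurable_fun setT Q.
Hypothesis Q_ge0 : forall x, 0 <= Q x.
Hypothesis taylor : forall eps : R, 0 < eps -> exists2 rho : R, 0 < rho &
  forall (t : R) x, 0 < t -> t ^+ 2 * Q x <= rho ->
    D (tuple_axpy b t x) /\
    `|E (tuple_axpy b t x) - 2^-1 * (t ^+ 2 * Q x)| <= eps * (t ^+ 2 * Q x).
Hypothesis far : forall rho : R, 0 < rho -> exists2 eta : R, 0 < eta &
  forall (t : R) x, 0 < t -> rho < t ^+ 2 * Q x -> D (tuple_axpy b t x) ->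
    eta <= E (tuple_axpy b t x).
Hypothesis K_ge0 : 0 <= K.
Hypothesis L_affine : forall t x, L (tuple_axpy b t x) = L b + t * L0 x.
Hypothesis L0_le : forall x, L0 x ^+ 2 <= K * Q x.

Definition weight (g : R) (Y : V) : R := \1_D Y * expR (L Y - g * E Y).

Hypothesis int_weight1 : (\int[mu]_Y (weight 1 Y)%:E < +oo)%E.
Hypothesis int_gauss : (\int[mu]_x (expR (- (8^-1 * Q x)))%:E < +oo)%E.

Variables (G : V -> R) (C : R).
Hypothesis mG : measurable_fun setT G.
Hypothesis G_ge0 : forall x, 0 <= G x.
Hypothesis G_le : forall x, G x <= C.

Variable t : nat -> R.
Hypothesis t_gt0 : forall m, 0 < t m.
Hypothesis t_le : forall m, t m <= 2^-1.
Hypothesis t_cvg0 : t m @[m --> \oo] --> 0.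

Lemma measurable_weight g : measurable_fun setT (weight g).
Proof.
apply: measurable_funM; first exact: measurable_indic.
apply: measurableT_comp => //; apply: measurable_funB => //.
by apply: measurable_funM => //; exact: measurable_cst.
Qed.

Lemma weight_ge0 g Y : 0 <= weight g Y.
Proof. by rewrite /weight mulr_ge0// ?expR_ge0// indicE ler0n. Qed.

Let gam m := (t m)^-1 ^+ 2 - 2.
Let F m x := G x * weight (gam m) (tuple_axpy b (t m) x).

Let mF m : measurable_fun setT (F m).
Proof.
apply: measurable_funM => //.
exact: measurableT_comp (measurable_weight _) (measurable_tuple_axpy _ _).
Qed.

Let F_ge0 m x : 0 <= F m x.
Proof. by rewrite mulr_ge0 ?weight_ge0. Qed.

Let gamt m : gam m * t m ^+ 2 = 1 - 2 * t m ^+ 2.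
Proof. by rewrite /gam; field; rewrite gt_eqF. Qed.

Let t2_le m : t m ^+ 2 <= 4^-1.
Proof. by have := t_le m; have := t_gt0 m; nra. Qed.

Let v_ge2 m : 2 <= (t m)^-1.
Proof. by rewrite -[leLHS]invrK lef_pV2 ?posrE. Qed.

Let gam_ge m : (t m)^-1 - 2 <= gam m.
Proof. by have := v_ge2 m; rewrite /gam; nra. Qed.

(** For fixed x the point b + t x ends up where the expansion holds. *)
Let near_small (A rho : R) : 0 < rho -> \forall m \near \oo, t m ^+ 2 * A <= rho.
Proof.
move=> rho0; have A0 : 0 < `|A| + 1 by rewrite ltr_wpDl.
have hn : \forall m \near \oo, t m <= rho / (`|A| + 1).
  exact: (cvgr_le _ t_cvg0 _ (divr_gt0 rho0 A0)).
apply: filterS hn => m h.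
apply: (@le_trans _ _ (t m * (`|A| + 1))); last by rewrite -ler_pdivlMr.
rewrite expr2 -mulrA ler_pM2l//.
have := ler_norm A; have := normr_ge0 A; have := t_le m; have := t_gt0 m; nra.
Qed.

(** The integral is split according to whether the point b + t x lies in the
    ellipsoid where E is at least a quarter of t^2 Q. Inside, the integrands are
    dominated by a Gaussian; outside, E is at least eta on D. *)
Section splitting.
Variable rho : R.
Hypothesis rho_gt0 : 0 < rho.
Hypothesis inner : forall (s : R) x, 0 < s -> s ^+ 2 * Q x <= rho ->
  D (tuple_axpy b s x) /\ 4^-1 * (s ^+ 2 * Q x) <= E (tuple_axpy b s x).

Let U m := [set x | t m ^+ 2 * Q x <= rho].

Let mU m : measurable (U m).
Proof.
rewrite -[X in measurable X]setTI.
have mq : measurable_fun setT (fun x => t m ^+ 2 * Q x).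
  by apply: measurable_funM => //; exact: measurable_cst.
have := mq measurableT (`]-oo, rho]%classic : set R) (measurable_itv _).
by congr (measurable (_ `&` _)); apply/seteqP; split => x /=; rewrite in_itv.
Qed.

Let Fin m x := \1_(U m) x * F m x.
Let Fout m x := \1_(~` U m) x * F m x.

Let mFin m : measurable_fun setT (Fin m).
Proof. by apply: measurable_funM => //; exact: measurable_indic. Qed.

Let mFout m : measurable_fun setT (Fout m).
Proof. by apply: measurable_funM => //; apply: measurable_indic; exact: measurableC. Qed.

Let dom := C * expR (L b + 1 + K * rho).

(** In the ellipsoid, gam * E is at least (1 - 2 t^2) Q / 4, which is at least
    Q / 8 because t <= 1/2, and L differs from L b by at most 1 + K * rho. *)
Let Fin_le m x : Fin m x <= dom * expR (- (8^-1 * Q x)).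
Proof.
have C_ge0 : 0 <= C by exact: le_trans (G_le x).
rewrite /Fin indicE; have [|_] := boolP (x \in U m); last first.
  by rewrite mul0r !mulr_ge0 ?expR_ge0.
rewrite inE => Ux; have [DY EY] := inner (t_gt0 m) Ux.
rewrite mul1r /F /weight indicE mem_set// mul1r /dom -mulrA -expRD.
apply: ler_pM => //.
rewrite ler_expR L_affine.
have h1 : t m * L0 x <= 1 + K * rho.
  have l1 : (t m * L0 x) ^+ 2 <= K * (t m ^+ 2 * Q x).
    by rewrite exprMn [leRHS]mulrCA ler_pM2l ?exprn_gt0.
  have l2 : K * (t m ^+ 2 * Q x) <= K * rho by rewrite ler_wpM2l.
  have := sqr_ge0 (t m * L0 x - 1); nra.
have h2 : 8^-1 * Q x <= gam m * E (tuple_axpy b (t m) x).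
  apply: (@le_trans _ _ (gam m * (4^-1 * (t m ^+ 2 * Q x)))); last first.
    by rewrite ler_wpM2l// (le_trans _ (gam_ge m))// subr_ge0.
  rewrite (_ : gam m * _ = 4^-1 * Q x * (gam m * t m ^+ 2)); last by ring.
  by rewrite gamt; have := t2_le m; have := Q_ge0 x; nra.
lra.
Qed.

Let Flim x := G x * expR (L b - 2^-1 * Q x).

Let F_cvg x : F m x @[m --> \oo] --> Flim x.
Proof.
pose r m := t m ^- 2 * E (tuple_axpy b (t m) x).
have r_cvg : r m @[m --> \oo] --> 2^-1 * Q x.
  apply/cvgrPdist_le => e e0.
  have e'0 : 0 < e / (Q x + 1) by rewrite divr_gt0// ltr_wpDl.
  have [rh rh0 hrh] := taylor e'0.
  have := near_small (Q x) rh0; apply: filterS => m hm.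
  have [_ h] := hrh _ _ (t_gt0 m) hm.
  have t20 : 0 < t m ^+ 2 by rewrite exprn_gt0.
  rewrite distrC /r.
  rewrite (_ : _ - _ = t m ^- 2 * (E (tuple_axpy b (t m) x)
     - 2^-1 * (t m ^+ 2 * Q x))); last by field; rewrite gt_eqF.
  rewrite normrM (ger0_norm (_ : 0 <= t m ^- 2)); last by rewrite invr_ge0 ltW.
  rewrite -ler_pdivlMl ?invr_gt0// invrK (le_trans h)//.
  rewrite mulrCA; apply: ler_wpM2l; first exact: ltW.
  by rewrite mulrAC ler_pdivrMr ?ltr_wpDl// ler_pM2l// lerDl.
have [rh rh0 hrh] := taylor (ltr01 : 0 < 1 :> R).
have e : \forall m \near \oo, G x * expR (L b + t m * L0 x
    - (1 - 2 * (t m * t m)) * r m) = F m x.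
  have := near_small (Q x) rh0; apply: filterS => m hm.
  have [DY _] := hrh _ _ (t_gt0 m) hm.
  rewrite /F /weight indicE mem_set// mul1r L_affine -expr2 -gamt /r.
  congr (_ * expR (_ - _)).
  by field; rewrite gt_eqF.
apply: cvg_trans (near_eq_cvg e) _.
have -> : Flim x = G x * expR (L b + 0 * L0 x - (1 - 2 * (0 * 0)) * (2^-1 * Q x)).
  by rewrite /Flim !mul0r mulr0 subr0 addr0 mul1r.
apply: cvgM; first exact: cvg_cst.
apply: continuous_cvg; first exact: continuous_expR.
apply: cvgB.
  by apply: cvgD; [exact: cvg_cst|apply: cvgM => //; exact: cvg_cst].
apply: cvgM => //; apply: cvgB; first exact: cvg_cst.
by apply: cvgM; [exact: cvg_cst|exact: cvgM].
Qed.

Let Fin_cvg : (\int[mu]_x (Fin m x)%:E)%E @[m --> \oo] --> (\int[mu]_x (Flim x)%:E)%E.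
Proof.
have mgauss : measurable_fun setT (fun x => expR (- (8^-1 * Q x))).
  apply: measurableT_comp => //; apply: measurableT_comp => //.
  by apply: measurable_funM => //; exact: measurable_cst.
have mlim : measurable_fun setT Flim.
  apply: measurable_funM => //; apply: measurableT_comp => //.
  apply: measurable_funB; first exact: measurable_cst.
  by apply: measurable_funM => //; exact: measurable_cst.
have [] // := @dominated_convergence _ _ _ mu setT measurableT
  (fun m x => (Fin m x)%:E) (fun x => (Flim x)%:E)
  (fun x => (dom * expR (- (8^-1 * Q x)))%:E).
- by move=> m; exact/measurable_EFinP.
- exact/measurable_EFinP.
- apply: aeW => x _; apply: cvg_EFin; first exact: nearW.
  have h : Fin m x @[m --> \oo] --> Flim x.
    have e : \forall m \near \oo, F m x = Fin m x.
      have := near_small (Q x) rho_gt0; apply: filterS => m hm.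
      by rewrite /Fin indicE mem_set// mul1r.
    by apply: cvg_trans (near_eq_cvg e) _; exact: F_cvg.
  exact: h.
- have C_ge0 : 0 <= C by exact: le_trans (G_le b).
  apply/integrableP; split.
    by apply/measurable_EFinP; apply: measurable_funM => //; exact: measurable_cst.
  under eq_integral => x _.
    rewrite gee0_abs ?lee_fin ?mulr_ge0 ?expR_ge0// EFinM; over.
  have d0 : (0 <= dom%:E)%E by rewrite lee_fin mulr_ge0 ?expR_ge0.
  have mg : measurable_fun setT (fun x => (expR (- (8^-1 * Q x)))%:E).
    exact/measurable_EFinP.
  have g0 x : setT x -> (0 <= (expR (- (8^-1 * Q x)))%:E)%E.
    by rewrite lee_fin expR_ge0.
  by rewrite ge0_integralZl//; apply: lte_mul_pinfty.
- apply: aeW => x m _; rewrite gee0_abs ?lee_fin ?Fin_le//.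
  by rewrite mulr_ge0.
Qed.

Variable eta : R.
Hypothesis eta_gt0 : 0 < eta.
Hypothesis outer : forall (s : R) x, 0 < s -> rho < s ^+ 2 * Q x ->
  D (tuple_axpy b s x) -> eta <= E (tuple_axpy b s x).

(** One unit of the exponent is kept, so that what remains is integrable; the
    others give the small factor. *)
Let Fout_le m x : Fout m x <=
  C * expR (- ((gam m - 1) * eta)) * weight 1 (tuple_axpy b (t m) x).
Proof.
have C_ge0 : 0 <= C by exact: le_trans (G_le x).
rewrite /Fout [X in X * _]indicE; have [|_] := boolP (x \in ~` U m); last first.
  by rewrite mul0r !mulr_ge0 ?expR_ge0 ?weight_ge0.
rewrite inE mul1r => /negP; rewrite -ltNge => Ux.
rewrite /F -mulrA; apply: ler_pM => //; first exact: weight_ge0.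
rewrite /weight indicE; have [|_] := boolP (_ \in D); last by rewrite !mul0r mulr0.
rewrite inE !mul1r -expRD ler_expR => DY.
have := outer (t_gt0 m) Ux DY => h.
suff : 0 <= gam m - 1 by nra.
by rewrite /gam; have := v_ge2 m; nra.
Qed.

Let I1 := fine (\int[mu]_Y (weight 1 Y)%:E)%E.
Let M := C * (expR (3 * eta) * (n.+1`!%:R / eta ^+ n.+1)) * I1.

(** Undoing the change of variables costs a factor t^-n, which the exponential
    absorbs: with v = 1/t, gam - 1 is at least v - 3, and v^n exp(- v eta) is at
    most a constant times 1/v. *)
Let int_Fout_le m : (\int[mu]_x (Fout m x)%:E <= (M * t m)%:E)%E.
Proof.
have C_ge0 : 0 <= C by exact: le_trans (G_le b).
have mw : measurable_fun setT (fun Y => (weight 1 Y)%:E).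
  by apply/measurable_EFinP; exact: measurable_weight.
have w0 Y : (0 <= (weight 1 Y)%:E)%E by rewrite lee_fin weight_ge0.
have I1E : (\int[mu]_Y (weight 1 Y)%:E)%E = I1%:E.
  by rewrite fineK// ge0_fin_numE// integral_ge0.
have I1_ge0 : 0 <= I1 by rewrite fine_ge0// integral_ge0.
pose c := C * expR (- ((gam m - 1) * eta)).
have c_ge0 : 0 <= c by rewrite mulr_ge0 ?expR_ge0.
apply: (@le_trans _ _ (\int[mu]_x (c%:E * (weight 1 (tuple_axpy b (t m) x))%:E))%E).
  apply: ge0_le_integral => //.
  - by move=> x _; rewrite lee_fin mulr_ge0.
  - exact/measurable_EFinP.
  - apply/measurable_EFinP; apply: measurable_funM; first exact: measurable_cst.
    exact: measurableT_comp (measurable_weight _) (measurable_tuple_axpy _ _).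
  - by move=> x _; rewrite -EFinM lee_fin Fout_le.
rewrite ge0_integralZl//; last first.
  exact: measurableT_comp mw (measurable_tuple_axpy _ _).
rewrite (ge0_integral_tuple_axpy b (t_gt0 m) mw w0) I1E -!EFinM lee_fin.
rewrite /c /M -!mulrA; apply: ler_wpM2l => //.
set v := (t m)^-1; have v2 : 2 <= v := v_ge2 m.
have v0 : 0 < v by lra.
have veta : 0 <= v * eta by rewrite mulr_ge0// ltW.
have e1 : expR (- ((gam m - 1) * eta)) <= expR (3 * eta) * expR (- (v * eta)).
  by rewrite -expRD ler_expR; have := gam_ge m; rewrite -/v; nra.
have e2 : expR (- (v * eta)) * v ^+ n <= n.+1`!%:R / eta ^+ n.+1 * t m.
  have := expR_ge1Dxn n veta.
  set fct := (n.+1`!%:R : R); have fct0 : 0 < fct by rewrite ltr0n fact_gt0.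
  move=> h; have h' : (v * eta) ^+ n.+1 / fct <= expR (v * eta).
    by apply: le_trans h; rewrite lerDr.
  rewrite expRN mulrC ler_pdivrMr ?expR_gt0//.
  have -> : v ^+ n = fct / eta ^+ n.+1 * t m * ((v * eta) ^+ n.+1 / fct).
    rewrite exprMn [v ^+ n.+1]exprSr (_ : t m = v^-1); last by rewrite invrK.
    have := exprn_gt0 n.+1 eta_gt0; move: (eta ^+ n.+1) => w wgt0.
    by field; rewrite !gt_eqF.
  apply: ler_wpM2l => //.
  by rewrite mulr_ge0 ?ltW// divr_gt0// exprn_gt0.
rewrite !mulrA [leRHS](_ : _ = expR (3 * eta) * (n.+1`!%:R / eta ^+ n.+1 * t m) * I1); last by ring.
apply: ler_wpM2r => //.
apply: (@le_trans _ _ (expR (3 * eta) * expR (- (v * eta)) * v ^+ n)).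
  by apply: ler_wpM2r => //; rewrite exprn_ge0// ltW.
by rewrite -mulrA; apply: ler_wpM2l => //; rewrite expR_ge0.
Qed.

Let Fout_cvg : (\int[mu]_x (Fout m x)%:E)%E @[m --> \oo] --> 0%E.
Proof.
apply: (@squeeze_cvge _ _ _ _ (fun=> 0%E) _ (fun m => (M * t m)%:E)).
- near=> m; rewrite int_Fout_le andbT integral_ge0// => x _.
  by rewrite lee_fin mulr_ge0.
- exact: cvg_cst.
- apply: cvg_EFin; first exact: nearW.
  have -> : (0 : R) = M * 0 by rewrite mulr0.
  by apply: cvgM => //; exact: cvg_cst.
Unshelve. all: by end_near. Qed.

Lemma laplace_split : (\int[mu]_x (F m x)%:E)%E @[m --> \oo] -->
  (\int[mu]_x (Flim x)%:E)%E.
Proof.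
have -> : (fun m => \int[mu]_x (F m x)%:E)%E =
   (fun m => \int[mu]_x (Fin m x)%:E + \int[mu]_x (Fout m x)%:E)%E.
  apply/funext => m; rewrite -ge0_integralD//.
  - apply: eq_integral => x _; rewrite -EFinD /Fin /Fout !indicE in_setC.
    by case: (x \in U m); rewrite /= ?mul1r ?mul0r ?addr0 ?add0r.
  - by move=> x _; rewrite lee_fin mulr_ge0.
  - exact/measurable_EFinP.
  - by move=> x _; rewrite lee_fin mulr_ge0.
  - exact/measurable_EFinP.
have -> : (\int[mu]_x (Flim x)%:E = \int[mu]_x (Flim x)%:E + 0)%E by rewrite adde0.
by apply: cvgeD => //; rewrite fin_num_adde_defl.
Qed.

End splitting.

Lemma laplace :
  (\int[mu]_x (G x * weight ((t m)^-1 ^+ 2 - 2) (tuple_axpy b (t m) x))%:E)%E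
    @[m --> \oo] -->
  (\int[mu]_x (G x * expR (L b - 2^-1 * Q x))%:E)%E.
Proof.
have [rho rho0 inner] := taylor (ltac:(by rewrite invr_gt0) : 0 < 4^-1 :> R).
have [eta eta0 outer] := far rho0.
apply: (@laplace_split rho) eta0 outer => //.
move=> s x s0 h; have [DY EY] := inner s x s0 h; split => //.
by move: EY; rewrite ler_norml => /andP[]; lra.
Qed.

End Laplace.

(** * The density of the corners process *)

Section CornersDensity.
Context {R : realType} {N : nat}.
Implicit Types (a z : N.-tuple R).

Lemma increment_scale a (s : R) k : (0 < k < N)%N ->
  increment [tuple s * tnth a i | i < N] k = s * increment a k.
Proof.
move=> /andP[k0 kN]; rewrite /increment.
have e j : (j < N)%N -> nth 0 [tuple s * tnth a i | i < N] j = s * nth 0 a j.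
  by move=> jN; rewrite -(tnth_nth _ _ (Ordinal jN)) tnth_mktuple (tnth_nth 0).
by rewrite !e ?mulrBr// (leq_ltn_trans (leq_pred k)).
Qed.

(** All the powers have exponent (2 - beta) times the charge of a link. In the
    exponent (2 - beta) (energy + drift / 2) + (beta / 2) drift the terms in beta
    drift cancel, and the drift is left with coefficient 1. *)
Lemma corners_density_ordered (beta : R) a z Y : ordered N (array z Y) ->
  corners_density beta [tuple beta / 2 * tnth a i | i < N] z Y =
  expR (drift N (increment a) (array z Y)
        - (beta - 2) * energy N (increment a) (array z Y)).
Proof.
move=> o; have [si _] := (strictly_interlacing_ordered z Y).2 o.
rewrite /corners_density indicE mem_set// mul1r -/(array z Y).
set y := array z Y.
have -> : \prod_(1 <= k < N)
     ((\prod_(1 <= i < k.+1) \prod_(i.+1 <= j < k.+1)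
         (y k i - y k j) `^ (2 - beta)) *
      (\prod_(1 <= p < k.+1) \prod_(1 <= q < k.+2)
         `|y k p - y k.+1 q| `^ (beta / 2 - 1))) =
  expR ((2 - beta) * \sum_(e <- links N) charge e * ln `|gap y e|).
  rewrite (sum_links _ (h := fun e => ln `|gap y e|)); last first.
    by move=> e; rewrite /gap distrC.
  rewrite mulr_sumr expR_sum; apply: eq_big_nat => k kN.
  have -> : forall A B : R, (2 - beta) * (A - 2^-1 * B) =
    (2 - beta) * A + (beta / 2 - 1) * B by move=> A B; field.
  rewrite expRD !mulr_sumr !expR_sum; congr (_ * _).
    apply: eq_big_nat => i ik; rewrite mulr_sumr expR_sum.
    apply: eq_big_nat => j ij; rewrite /gap/=.
    have h : 0 < y k i - y k j.
      have /o : ((k, i), (k, j)) \in links N by apply: level_link_in => //; lia.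
      by [].
    by rewrite /powR gt_eqF// gtr0_norm.
  apply: eq_big_nat => p pk; rewrite mulr_sumr expR_sum.
  apply: eq_big_nat => q qk; rewrite /gap/= /powR ifF//.
  apply/negbTE; rewrite normr_eq0.
  have /lt0r_neq0 := o _ (cross_link_in kN pk qk).
  rewrite /cross_link /gap; case: ifP => _ //=.
  by rewrite -opprB oppr_eq0.
rewrite -expRD; congr expR; rewrite /energy.
have -> : \sum_(e <- links N) charge e * ln `|gap y e| =
   \sum_(e <- links N) charge e * ln (gap y e).
  by apply: eq_big_seq => e eN; rewrite gtr0_norm ?o.
have -> : \sum_(1 <= k < N) \sum_(1 <= i < k.+1) y k i *
     increment [tuple beta / 2 * tnth a i | i < N] k =
   beta / 2 * drift N (increment a) y.
  rewrite /drift mulr_sumr; apply: eq_big_nat => k kN.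
  rewrite mulr_sumr; apply: eq_bigr => i _.
  by rewrite increment_scale//; ring.
by field.
Qed.

(** When two entries of consecutive levels coincide, a factor 0 `^ (beta / 2 - 1)
    vanishes because its exponent is positive. Boundary points are thus excluded
    exactly, not only almost everywhere. *)
Lemma corners_density_unordered (beta : R) a z Y : 2 < beta ->
  ~ ordered N (array z Y) -> corners_density beta a z Y = 0.
Proof.
move=> beta2 no; rewrite /corners_density indicE.
have [|_] := boolP (Y \in _); last by rewrite !mul0r.
rewrite inE /= => wi.
have [k [i [j [kN ik jk yE]]]] : exists k i j, [/\ (1 <= k < N)%N,
    (1 <= i <= k)%N, (1 <= j <= k.+1)%N & array z Y k i = array z Y k.+1 j].
  apply: contrapT => h; apply/no/(strictly_interlacing_ordered z Y).
  split => // k i j kN ik jk; apply/eqP => e; apply: h.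
  by exists k, i, j.
rewrite (_ : \prod_(1 <= k < N) _ = 0) ?mulr0 ?mul0r//.
rewrite (big_rem k) ?mem_index_iota//= [X in _ * X * _](_ : _ = 0) ?mulr0 ?mul0r//.
rewrite (big_rem i) ?mem_index_iota//= [X in X * _](_ : _ = 0) ?mul0r//.
rewrite (big_rem j) ?mem_index_iota//= -/(array z Y) yE subrr normr0.
by rewrite powR0 ?mul0r// gt_eqF//; lra.
Qed.

End CornersDensity.

(** * Convergence to the Gaussian field *)

Section LatticeEstimates.
Context {R : realType} {N : nat}.
Variables (a z : N.-tuple R) (ybar : 'C(N, 2).-tuple R).
Hypothesis lattice : deformed_lattice a z ybar.

Let y := array z ybar.
Let c := increment a.

Lemma lattice_ordered : ordered N y.
Proof. by apply/strictly_interlacing_ordered; case: lattice. Qed.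

Definition excess (Y : 'C(N, 2).-tuple R) : R := energy N c (array z Y) - energy N c y.

Definition curvature (x : 'C(N, 2).-tuple R) : R := qform N y (direction x).

Lemma curvature_ge0 x : 0 <= curvature x.
Proof. by apply: qform_ge0; [exact: lattice_ordered|move=> i; exact: direction_top]. Qed.

Let addscale1 (t : R) (x : nat -> nat -> R) :
  addscale y 1 (fun k i => t * x k i) = addscale y t x.
Proof. by apply/funext => k; apply/funext => i; rewrite /addscale mul1r. Qed.

Let scaled_top (t : R) (x : 'C(N, 2).-tuple R) i : t * direction x N i = 0 :> R.
Proof. by rewrite direction_top mulr0. Qed.

Lemma excess_taylor (eps : R) : 0 < eps -> exists2 rho : R, 0 < rho &
  forall (t : R) x, 0 < t -> t ^+ 2 * curvature x <= rho ->
    ordered N (array z (tuple_axpy ybar t x)) /\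
    `|excess (tuple_axpy ybar t x) - 2^-1 * (t ^+ 2 * curvature x)|
      <= eps * (t ^+ 2 * curvature x).
Proof.
move=> eps0; have [rho rho0 H] :=
  energy_taylor2 lattice_ordered (lattice_slope0 lattice) eps0.
exists rho => // t x t0; rewrite -qform_scale => h.
have := H _ (scaled_top t x) h.
by rewrite addscale1 /excess array_axpy.
Qed.

(** The ray from the lattice to the point crosses the ellipsoid where the Hessian
    form equals r, and there the expansion gives at least r / 4; from there on the energy does not
    decrease. *)
Lemma excess_far (rho : R) : 0 < rho -> exists2 eta : R, 0 < eta &
  forall (t : R) x, 0 < t -> rho < t ^+ 2 * curvature x ->
    ordered N (array z (tuple_axpy ybar t x)) -> eta <= excess (tuple_axpy ybar t x).
Proof.
move=> rho0; have [rho1 rho10 H] := excess_taylor (ltac:(by rewrite invr_gt0) : 0 < 4^-1 :> R).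
pose r := Num.min rho rho1.
have r0 : 0 < r by rewrite lt_min rho0.
exists (4^-1 * r); first by rewrite mulr_gt0.
move=> t x t0 far o; set q := t ^+ 2 * curvature x.
have q0 : 0 < q by exact: lt_trans far.
pose s := Num.sqrt (r / q).
have s2 : s ^+ 2 = r / q by rewrite sqr_sqrtr// divr_ge0// ltW.
have s0 : 0 < s by rewrite sqrtr_gt0 divr_gt0.
have s1 : s <= 1.
  rewrite -ler_sqr ?nnegrE ?ler01 ?(ltW s0)// s2 expr1n ler_pdivrMr// mul1r.
  by rewrite (le_trans _ (ltW far))// ge_min lexx.
have qs : (s * t) ^+ 2 * curvature x = r.
  by rewrite exprMn -mulrA s2 -/q mulfVK// gt_eqF.
have [] := H (s * t) x (mulr_gt0 s0 t0).
  by rewrite qs ge_min lexx orbT.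
rewrite qs ler_norml => _ /andP[h _].
apply: (@le_trans _ _ (excess (tuple_axpy ybar (s * t) x))); first by lra.
rewrite /excess lerD2r !array_axpy.
have -> : addscale y (s * t) (direction x) = addscale y s (fun k i => t * direction x k i).
  by apply/funext => k; apply/funext => i; rewrite /addscale mulrA.
rewrite -[addscale y t _]addscale1; apply: energy_ray_nondecreasing.
- exact: lattice_ordered.
- by rewrite addscale1 -array_axpy.
- exact: scaled_top.
- by apply: lattice_slope0 => //; exact: scaled_top.
- by rewrite s0.
Qed.

Lemma drift_sqr_le : exists2 K : R, 0 <= K &
  forall x, drift N c (direction x) ^+ 2 <= K * curvature x.
Proof.
have [C C0 HC] := qform_coercive lattice_ordered.
pose S : R := \sum_(1 <= k < N) \sum_(1 <= i < k.+1) `|c k|.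
exists (S ^+ 2 * C); first by rewrite mulr_ge0 ?sqr_ge0// ltW.
move=> x; have q0 := curvature_ge0 x.
have Cq0 : 0 <= C * curvature x by rewrite mulr_ge0// ltW.
have S0 : 0 <= S by apply: sumr_ge0 => k _; apply: sumr_ge0.
have h : `|drift N c (direction x)| <= S * Num.sqrt (C * curvature x).
  rewrite /drift /S mulr_suml; apply: (le_trans (ler_norm_sum _ _ _)).
  apply: ler_sum_nat => k kN; rewrite mulr_suml.
  apply: (le_trans (ler_norm_sum _ _ _)); apply: ler_sum_nat => i ik.
  rewrite normrM mulrC; apply: ler_wpM2l => //.
  rewrite -sqrtr_sqr ler_sqrt//; apply: HC => //; [exact: direction_top|lia].
rewrite -real_normK ?num_real//.
have -> : S ^+ 2 * C * curvature x = (S * Num.sqrt (C * curvature x)) ^+ 2.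
  by rewrite exprMn sqr_sqrtr// mulrA.
by rewrite ler_sqr ?nnegrE// mulr_ge0// sqrtr_ge0.
Qed.

Lemma curvature_scale s x :
  curvature (tuple_axpy [tuple of nseq 'C(N, 2) 0] s x) = s ^+ 2 * curvature x.
Proof.
rewrite /curvature -qform_scale; congr qform.
rewrite {1}/direction array_axpy; apply/funext => k; apply/funext => i.
rewrite /addscale -/(direction _) directionE.
by case: ifP => _; rewrite ?nth_nseq ?if_same add0r.
Qed.

Local Notation mu := (lebesgue_tuple R 'C(N, 2)).
Local Notation D := [set Y | ordered N (array z Y)].
Local Notation L := (fun Y => drift N c (array z Y)).

Lemma corners_density_weight (beta : R) Y : 2 < beta ->
  corners_density beta [tuple beta / 2 * tnth a i | i < N] z Y =
  expR (- ((beta - 2) * energy N c y)) * weight D excess L (beta - 2) Y.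
Proof.
move=> beta2; rewrite /weight indicE.
have [|] := boolP (Y \in D); rewrite ?inE ?notin_setE/= => o.
  rewrite corners_density_ordered// mul1r -expRD; congr expR.
  by rewrite /excess -/c; ring.
by rewrite corners_density_unordered// mul0r mulr0.
Qed.

End LatticeEstimates.

Section Normalisation.
Context {R : realType}.

(** Here k m and k0 are normalising constants, and J1 and J the integrals of the
    weights, alone and against a test function. *)
Lemma cvg_normalised (k : nat -> R) (k0 : R) (J J1 : nat -> \bar R) (j j1 : \bar R) :
  (forall m, 0 < k m) -> 0 < k0 ->
  (forall m, (k m)%:E * J1 m = 1)%E -> (k0%:E * j1 = 1)%E ->
  J1 m @[m --> \oo] --> j1 -> J m @[m --> \oo] --> j ->
  ((k m)%:E * J m)%E @[m --> \oo] --> (k0%:E * j)%E.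
Proof.
move=> kp k0p kJ kj cJ1 cJ.
have inv (r : R) e : 0 < r -> (r%:E * e = 1)%E -> e = r^-1%:E.
  move=> r0; case: e => [e| |].
  - by rewrite -EFinM => -[] h; congr EFin; rewrite -[RHS]mulr1 -h mulKf// gt_eqF.
  - by rewrite gt0_muley ?lte_fin.
  - by rewrite gt0_muleNy ?lte_fin.
have kc : k m @[m --> \oo] --> k0.
  have h : (k m)^-1 @[m --> \oo] --> k0^-1.
    have cJ1' : ((k m)^-1)%:E @[m --> \oo] --> (k0^-1)%:E.
      rewrite -(inv _ _ k0p kj).
      by under eq_fun do rewrite -(inv _ _ (kp _) (kJ _)).
    exact: (fine_cvg cJ1').
  have -> : k = (fun m => (k m)^-1^-1) by apply/funext => m; rewrite invrK.
  by rewrite -[k0]invrK; apply: cvgV => //; rewrite invr_eq0 gt_eqF.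
apply: cvgeM => //; first by rewrite /mule_def; case: (j) => //; rewrite gt_eqF.
by apply: cvg_EFin; [exact: nearW|exact: kc].
Qed.

Lemma integral_probability1 d (T : measurableType d) (P : probability T R) :
  (\int[P]_w 1%:E = 1)%E.
Proof. by rewrite integral_cst// mul1e; exact: probability_setT. Qed.

Lemma expectation_bounded_fin_num d (T : measurableType d) (P : probability T R)
    (h : T -> R) (C : R) : measurable_fun setT h -> (forall w, `|h w| <= C) ->
  'E_P[h]%E \is a fin_num.
Proof.
move=> mh hC; rewrite unlock; apply: integrable_fin_num => //.
apply: (le_integrable measurableT (g := fun=> C%:E)).
- exact/measurable_EFinP.
- by move=> w _; rewrite /= lee_fin (le_trans (hC w))// ler_norm.
- exact: finite_measure_integrable_cst.
Qed.

(** Reduces bounded functions to nonnegative ones. *)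
Lemma expectation_shift d (T : measurableType d) (P : probability T R)
    (h : T -> R) (C : R) : measurable_fun setT h -> (forall w, `|h w| <= C) ->
  ('E_P[h] = \int[P]_w (h w + C)%:E - C%:E)%E.
Proof.
move=> mh hC; rewrite unlock.
have C0 w : 0 <= h w + C by have := hC w; rewrite ler_norml => /andP[]; lra.
have mhC : measurable_fun setT (fun w => h w + C).
  by apply: measurable_funD => //; exact: measurable_cst.
have int_cst (r : R) : P.-integrable setT (fun=> r%:E).
  exact: finite_measure_integrable_cst.
have ihC : P.-integrable setT (fun w => (h w + C)%:E).
  apply: (le_integrable measurableT _ _ (int_cst (C + C))).
    exact/measurable_EFinP.
  move=> w _; rewrite /= lee_fin !ger0_norm//.
    by rewrite lerD2r (le_trans (ler_norm _))//.
  by have := C0 w; have := le_trans (ler_norm _) (hC w); lra.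
transitivity (\int[P]_w ((h w + C)%:E - C%:E))%E.
  by apply: eq_integral => w _; rewrite -EFinB addrK.
rewrite (integralB measurableT ihC (int_cst C)).
rewrite integral_cst// -[in RHS](mule1 C%:E); congr (_ - _ * _)%E.
exact: probability_setT.
Qed.

End Normalisation.
Section Blowup.
Context {R : realType} {n : nat}.

(** The inverse of [tuple_axpy b s^-1]. *)
Definition blowup (b : n.-tuple R) (s : R) (Y : n.-tuple R) : n.-tuple R :=
  [tuple s * (tnth Y i - tnth b i) | i < n].

Lemma blowupK (b : n.-tuple R) (t : R) x : t != 0 ->
  blowup b t^-1 (tuple_axpy b t x) = x.
Proof.
move=> t0; apply: eq_from_tnth => i; rewrite !tnth_mktuple.
by rewrite addrAC subrr add0r mulKf.
Qed.

Lemma measurable_blowup (b : n.-tuple R) s : measurable_fun setT (blowup b s).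
Proof.
apply/measurable_fun_tnthP => i.
rewrite (_ : _ \o _ = fun x => s * (tnth x i - tnth b i)); last first.
  by apply/funext => x /=; rewrite tnth_mktuple.
apply: measurable_funM; first exact: measurable_cst.
by apply: measurable_funB; [exact: measurable_tnth|exact: measurable_cst].
Qed.

End Blowup.

Lemma nth_full_array (R : realType) N (z : N.-tuple R) Y m :
  nth 0 (full_array z Y) m =
  if (m < 'C(N, 2))%N then nth 0 Y m else nth 0 z (m - 'C(N, 2)).
Proof. by rewrite /full_array /= nth_cat size_tuple. Qed.

Lemma le_sqrtr (R : realType) (x w : R) : 0 <= x -> x ^+ 2 <= w -> x <= Num.sqrt w.
Proof. by move=> x0 xw; rewrite -(ger0_norm x0) -sqrtr_sqr; exact: ler_wsqrtr. Qed.

Theorem theorem5p12 (R : realType) (N : nat) (hN : (1 <= N)%N)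
    (z : N.-tuple R) (hz : forall i j : 'I_N, (i < j)%N -> tnth z j < tnth z i)
    (a : N.-tuple R)
    (d : R -> measure_display) (T : forall beta : R, measurableType (d beta))
    (P : forall beta : R, probability (T beta) R)
    (Y : forall beta : R, {RV (P beta) >-> 'C(N, 2).-tuple R})
    (hY : forall beta : R, 0 < beta ->
      has_density_prop (Y beta)
        (corners_density beta [tuple beta / 2 * tnth a i | i < N] z))
    (ybar : 'C(N, 2).-tuple R) (hybar : deformed_lattice a z ybar)
    (d' : measure_display) (T' : measurableType d') (P' : probability T' R)
    (zeta : {RV P' >-> 'C(N, 2).-tuple R})
    (hzeta : has_density_prop zeta
      (gaussian_weight (hessian (hamiltonian a z) ybar))) :
  cvg_in_distribution +oo P P'
    (fun (beta : R) w => Num.sqrt beta *: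
       (row_of_tuple (full_array z (Y beta w))
        - row_of_tuple (full_array z ybar)))
    (fun w => row_of_tuple (full_array [tuple of nseq N 0] (zeta w))).
Proof.
move=> g cg bg.
pose X beta (w : T beta) := Num.sqrt beta *:
   (row_of_tuple (full_array z (Y beta w)) - row_of_tuple (full_array z ybar)).
pose X' (w : T') := row_of_tuple (full_array [tuple of nseq N 0] (zeta w)).
change ('E_(P beta)[g \o X beta]%E @[beta --> +oo] --> 'E_P'[g \o X']%E).
have [C C0 gC] : exists2 C : R, 0 < C & forall v, `|g v| <= C.
  have [M [Mr hM]] := bg; exists (`|M| + 1); first by rewrite ltr_wpDl.
  by move=> v; apply: hM => //; rewrite ltr_pwDr// ler_norm.
pose n := 'C(N, 2).
pose mu := lebesgue_tuple R n.
pose y := array z ybar.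
pose D : set (n.-tuple R) := [set Y0 | ordered N (array z Y0)].
pose E := excess a z ybar.
pose L (Y0 : n.-tuple R) := drift N (increment a) (array z Y0).
pose L0 (x : n.-tuple R) := drift N (increment a) (direction x).
pose Q := curvature z ybar.
pose G (x : n.-tuple R) := g (row_of_tuple (full_array [tuple of nseq N 0] x)) + C.
have G_ge0 x : 0 <= G x.
  by have := gC (row_of_tuple (full_array [tuple of nseq N 0] x));
    rewrite ler_norml /G => /andP[]; lra.
have G_le x : G x <= C + C.
  by rewrite lerD2r (le_trans (ler_norm _)).
have mG : measurable_fun setT G.
  apply: measurable_funD; last exact: measurable_cst.
  exact: measurableT_comp (measurable_continuous_row cg) (measurable_full_array _).
have [K K0 L0_le] := drift_sqr_le hybar.
have mD : measurable D by exact: measurable_ordered.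
have mE : measurable_fun setT E.
  by apply: measurable_funB; [exact: measurable_energy|exact: measurable_cst].
have mL : measurable_fun setT L by exact: measurable_drift.
have mQ : measurable_fun setT Q by exact: measurable_qform.
have L_affine (t : R) x : L (tuple_axpy ybar t x) = L ybar + t * L0 x.
  by rewrite /L /L0 array_axpy drift_addscale.
have Q0 := curvature_ge0 hybar.
have mw (gm : R) : measurable_fun setT (weight D E L gm).
  exact: measurable_weight.
have w0 (gm : R) Y0 : 0 <= weight D E L gm Y0 by exact: weight_ge0.
pose kap (beta : R) := expR (- ((beta - 2) * energy N (increment a) y)).
have densE (beta : R) : 2 < beta -> corners_density beta [tuple beta / 2 * tnth a i | i < N] z =
    (fun Y0 => kap beta * weight D E L (beta - 2) Y0).
  by move=> b2; apply/funext => Y0; exact: corners_density_weight.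
(* The laws of the process and of the field, with unspecified constants. *)
have law (beta : R) : 2 < beta -> exists2 k : R, 0 < k &
    forall H : n.-tuple R -> R, (forall x, 0 <= H x) -> measurable_fun setT H ->
    (\int[P beta]_w (H (Y beta w))%:E =
     k%:E * \int[mu]_x (H x * weight D E L (beta - 2) x)%:E)%E.
  move=> b2; have b0 : 0 < beta by exact: lt_trans b2.
  have [c c0 hc] := hY _ b0; rewrite densE// in hc.
  exists (c * kap beta); first by rewrite mulr_gt0 ?expR_gt0.
  move=> H H0 mH.
  apply: (@ge0_expectation_density _ _ _ _ _ (Y beta) (weight D E L (beta - 2))
    (c * kap beta) H) => //.
    by rewrite mulr_ge0 ?expR_ge0// ltW.
  by move=> A mA; rewrite hc//; apply: eq_integral => x _; rewrite mulrA.
have [k' k'0 law'] : exists2 k : R, 0 < k &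
    forall H : n.-tuple R -> R, (forall x, 0 <= H x) -> measurable_fun setT H ->
    (\int[P']_w (H (zeta w))%:E =
     k%:E * \int[mu]_x (H x * expR (L ybar - 2^-1 * Q x))%:E)%E.
  have [c c0 hc] := hzeta.
  exists (c * expR (- L ybar)); first by rewrite mulr_gt0 ?expR_gt0.
  move=> H H0 mH.
  apply: (@ge0_expectation_density _ _ _ _ _ zeta (fun x => expR (L ybar - 2^-1 * Q x))
    (c * expR (- L ybar)) H) => //.
  - by rewrite mulr_ge0 ?expR_ge0// ltW.
  - apply: measurableT_comp => //; apply: measurable_funB; first exact: measurable_cst.
    by apply: measurable_funM => //; exact: measurable_cst.
  move=> A mA; rewrite hc//; apply: eq_integral => x _.
  rewrite gaussian_weightE//; last exact: lattice_ordered hybar.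
  by rewrite -mulrA -expRD addKr.
have one_ge0 : forall x : n.-tuple R, 0 <= (1 : R) by [].
have mone : measurable_fun setT (fun _ : n.-tuple R => 1 : R) by exact: measurable_cst.
(* The weight with exponent 1 is the density at beta = 3, hence integrable. *)
have int_weight1 : (\int[mu]_Y0 (weight D E L 1 Y0)%:E < +oo)%E.
  have [k k0 hk] := law 3 ltac:(by rewrite ltr_nat).
  have := hk _ one_ge0 mone.
  under [in X in _ = X -> _]eq_integral do rewrite mul1r.
  rewrite integral_probability1.
  rewrite (_ : 3 - 2 = 1 :> R); last by ring.
  case: (\int[mu]_Y0 _)%E => [r _||//]; first exact: ltry.
  by rewrite gt0_muley ?lte_fin.
(* The dominating function exp(- Q / 8) is the Gaussian weight at x / 2, and the
   existence of the field says that the Gaussian weight is integrable. *)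
have int_gauss : (\int[mu]_x (expR (- (8^-1 * Q x)))%:E < +oo)%E.
  have mgw : measurable_fun setT (fun x => (expR (- (2^-1 * Q x)))%:E).
    apply/measurable_EFinP; apply: measurableT_comp => //.
    apply: measurableT_comp => //.
    by apply: measurable_funM; [exact: measurable_cst|exact: mQ].
  have gw0 x : (0 <= (expR (- (2^-1 * Q x)))%:E)%E by rewrite lee_fin expR_ge0.
  have h2 : 0 < 2^-1 :> R by rewrite invr_gt0.
  have := ge0_integral_tuple_axpy [tuple of nseq n 0] h2 mgw gw0.
  under eq_integral => x _.
    rewrite /Q curvature_scale -/Q.
    rewrite (_ : 2^-1 * _ = 8^-1 * Q x); last by field.
    over.
  move=> ->; apply: lte_mul_pinfty => //.
  have [c c0 hc] := hzeta.
  have := hc setT measurableT; rewrite probability_setT.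
  under eq_integral => x _.
    rewrite gaussian_weightE; last exact: lattice_ordered hybar.
    rewrite EFinM; over.
  rewrite ge0_integralZl//; last by rewrite lee_fin ltW.
  case: (\int[mu]_x _)%E => [r _||//]; first exact: ltry.
  by rewrite gt0_muley ?lte_fin.
have lim (H : n.-tuple R -> R) (M : R) (t : nat -> R) :
    (forall x, 0 <= H x) -> (forall x, H x <= M) -> measurable_fun setT H ->
    (forall m, 0 < t m) -> (forall m, t m <= 2^-1) -> t m @[m --> \oo] --> 0 ->
    (\int[mu]_x (H x * weight D E L ((t m)^-1 ^+ 2 - 2) (tuple_axpy ybar (t m) x))%:E)%E
      @[m --> \oo] --> (\int[mu]_x (H x * expR (L ybar - 2^-1 * Q x))%:E)%E.
  move=> H0 HM mH tp tl tc.
  apply: (@laplace R n ybar D E L L0 Q K) => //.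
    exact: excess_taylor.
  exact: excess_far.
have E'E : ('E_P'[g \o X'] = \int[P']_w (G (zeta w))%:E - C%:E)%E.
  rewrite (@expectation_shift _ _ _ _ _ C)// => [|w]; last exact: gC.
  apply: (measurableT_comp (measurable_continuous_row cg)).
  exact: (measurableT_comp (measurable_full_array _)).
have XE beta w : X beta w = row_of_tuple (full_array [tuple of nseq N 0]
    (blowup ybar (Num.sqrt beta) (Y beta w))).
  apply/rowP => i; rewrite /X !mxE !(tnth_nth 0) !nth_full_array.
  case: ltnP => h; last by rewrite subrr mulr0 nth_nseq if_same.
  have e (t : n.-tuple R) : nth 0 t i = tnth t (Ordinal h) by rewrite (tnth_nth 0).
  by rewrite !e tnth_mktuple.
have mX' : measurable_fun setT (g \o X').
  apply: (measurableT_comp (measurable_continuous_row cg)).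
  exact: (measurableT_comp (measurable_full_array _)).
have mX beta : measurable_fun setT (g \o X beta).
  rewrite (_ : g \o X beta = fun w => g (row_of_tuple (full_array [tuple of nseq N 0]
    (blowup ybar (Num.sqrt beta) (Y beta w))))).
    apply: (measurableT_comp (measurable_continuous_row cg)).
    apply: (measurableT_comp (measurable_full_array _)).
    exact: (measurableT_comp (measurable_blowup _ _)).
  by apply/funext => w; rewrite /= XE.
have EE beta : ('E_(P beta)[g \o X beta] =
    \int[P beta]_w (G (blowup ybar (Num.sqrt beta) (Y beta w)))%:E - C%:E)%E.
  rewrite (@expectation_shift _ _ _ _ _ C)// => [|w]; last exact: gC.
  by congr (_ - _)%E; apply: eq_integral => w _; rewrite /G -XE.
have sqrt_gt0 (v : R) : 4 <= v -> 0 < Num.sqrt v.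
  by move=> v4; rewrite sqrtr_gt0 (lt_le_trans _ v4).
(* The bound 4 on beta makes t = 1/sqrt beta at most 1/2. *)
have seq_cvg (v : nat -> R) : (forall m, 4 <= v m) -> v m @[m --> \oo] --> +oo ->
    'E_(P (v m))[g \o X (v m)]%E @[m --> \oo] --> 'E_P'[g \o X']%E.
  move=> v4 v_oo.
  pose t m := (Num.sqrt (v m))^-1.
  have tp m : 0 < t m by rewrite invr_gt0 sqrt_gt0.
  have tl m : t m <= 2^-1.
    by rewrite lef_pV2 ?posrE ?sqrt_gt0//; apply: le_sqrtr => //; rewrite -natrX.
  have tc : t m @[m --> \oo] --> 0.
    apply/cvgrPdist_le => e e0.
    have hv : \forall m \near \oo, e^-1 ^+ 2 <= v m by move/cvgryPge : v_oo; exact.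
    apply: filterS hv => m hm.
    rewrite sub0r normrN ger0_norm ?(ltW (tp m))//.
    rewrite -[leRHS]invrK lef_pV2 ?posrE ?invr_gt0 ?sqrt_gt0//.
    by apply: le_sqrtr => //; rewrite invr_ge0 ltW.
  have tv m : (t m)^-1 ^+ 2 = v m.
    by rewrite invrK sqr_sqrtr// (le_trans _ (v4 m)).
  pose J (H : n.-tuple R -> R) m := (\int[mu]_x
    (H x * weight D E L ((t m)^-1 ^+ 2 - 2) (tuple_axpy ybar (t m) x))%:E)%E.
  have /choice[k hk] : forall m, exists k : R, 0 < k /\
      forall H : n.-tuple R -> R, (forall x, 0 <= H x) -> measurable_fun setT H ->
      (\int[P (v m)]_w (H (blowup ybar (Num.sqrt (v m)) (Y (v m) w)))%:E =
       k%:E * J H m)%E.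
    move=> m; have [|k k0 hk] := law (v m).
      by rewrite (lt_le_trans _ (v4 m))// ltr_nat.
    exists (k * t m ^+ n); split; first by rewrite mulr_gt0 ?exprn_gt0.
    move=> H H0 mH.
    have mHb : measurable_fun setT (H \o blowup ybar (Num.sqrt (v m))).
      exact: measurableT_comp mH (measurable_blowup _ _).
    rewrite (hk _ (fun x => H0 (blowup ybar (Num.sqrt (v m)) x)) mHb).
    pose f Y0 := (H (blowup ybar (Num.sqrt (v m)) Y0) * weight D E L (v m - 2) Y0)%:E.
    have mf : measurable_fun setT f.
      by apply/measurable_EFinP; apply: measurable_funM.
    have f0 Y0 : (0 <= f Y0)%E by rewrite lee_fin mulr_ge0.
    have JE : (J H m = ((t m)^-1 ^+ n)%:E * \int[mu]_Y0 f Y0)%E.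
      rewrite -(ge0_integral_tuple_axpy ybar (tp m) mf f0).
      apply: eq_integral => x _; rewrite /f tv.
      have -> : Num.sqrt (v m) = (t m)^-1 by rewrite /t invrK.
      by rewrite blowupK// gt_eqF.
    rewrite JE muleA -EFinM -mulrA -exprMn mulfV ?gt_eqF// expr1n mulr1.
    by [].
  have lawJ m H := (hk m).2 H.
  rewrite E'E (law' G G_ge0 mG).
  under eq_fun do rewrite EE (lawJ _ _ G_ge0 mG).
  apply: cvgeB; [by rewrite fin_num_adde_defl| |exact: cvg_cst].
  apply: (@cvg_normalised _ k k' (J G) (J (fun=> 1)) _
     (\int[mu]_x (1 * expR (L ybar - 2^-1 * Q x))%:E)%E) => //.
  - by move=> m; exact: (hk m).1.
  - by move=> m; rewrite -lawJ// integral_probability1.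
  - by rewrite -(law' (fun=> 1))// integral_probability1.
  - by apply: (lim (fun=> 1) 1).
  - by apply: (lim G (C + C)).
have psi_fin beta : 'E_(P beta)[g \o X beta]%E \is a fin_num.
  exact: (@expectation_bounded_fin_num _ _ _ (P beta) _ C (mX beta) (fun w => gC (X beta w))).
have E'_fin : 'E_P'[g \o X']%E \is a fin_num.
  exact: (@expectation_bounded_fin_num _ _ _ P' _ C mX' (fun w => gC (X' w))).
rewrite -[X in _ --> X](fineK E'_fin); apply: cvg_EFin; first exact: nearW.
apply/cvg_pinftyP => u u_oo.
have u4 : \forall m \near \oo, 4 <= u m by move/cvgryPge : u_oo; exact.
(* Only large beta matter: the sequence is replaced by one bounded below by 4. *)
pose v m := Num.max (u m) 4.
have uv : \forall m \near \oo, u m = v m.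
  by apply: filterS u4 => m; rewrite /v => /max_idPl.
have v_oo : v m @[m --> \oo] --> +oo.
  apply: cvg_trans u_oo; apply: near_eq_cvg.
  exact: uv.
have v4 m : 4 <= v m by rewrite le_max lexx orbT.
have h := seq_cvg v v4 v_oo; rewrite -(fineK E'_fin) in h.
apply: cvg_trans (fine_cvg h); apply: near_eq_cvg.
by apply: filterS uv => m /= ->.
Qed.
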